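(* Let $(\sigma,V^{(1)},V^{(2)})$ be a pure isometric covariant representation of the product system $\mathbb E$ over $\mathbb N_0^2$ on a Hilbert space $\mathcal H$. Then the BCL-representation $(\rho,M_{\Theta_1},M_{\Theta_2})$ of $(\sigma,V^{(1)},V^{(2)})$ is given by $$\widetilde\Theta_1=\big(P_{\mathcal W_1}^\perp+\widetilde S(I_{E_1\otimes E_2}\otimes P_{\mathcal W_1})\big)U',\qquad \widetilde\Theta_2=\big(P_{\mathcal W_2}^\perp+\widetilde S(t_{2,1}\otimes P_{\mathcal W_2})\big)U,$$ where $$U'=\begin{bmatrix}\widetilde V^{(1)}|_{E_1\otimes\mathcal W_2}&0\\0&I_{E_1}\otimes\widetilde V^{(2)*}|_{\widetilde V^{(2)}(E_2\otimes\mathcal W_1)}\end{bmatrix}:E_1\otimes\mathcal W_2\oplus E_1\otimes\widetilde V^{(2)}(E_2\otimes\mathcal W_1)\to\widetilde V^{(1)}(E_1\otimes\mathcal W_2)\oplus E\otimes\mathcal W_1$$ and $$U=\begin{bmatrix}\widetilde V^{(2)}|_{E_2\otimes\mathcal W_1}&0\\0&I_{E_2}\otimes\widetilde V^{(1)*}|_{\widetilde V^{(1)}(E_1\otimes\mathcal W_2)}\end{bmatrix}:E_2\otimes\mathcal W_1\oplus E_2\otimes\widetilde V^{(1)}(E_1\otimes\mathcal W_2)\to\widetilde V^{(2)}(E_2\otimes\mathcal W_1)\oplus E_2\otimes E_1\otimes\mathcal W_2$$ are unitary isomorphisms. Here $P_{\mathcal W_i}$ is the orthogonal projection of $\mathcal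 W$ onto $\mathcal W_i$, $P_{\mathcal W_i}^\perp=I_{\mathcal W}-P_{\mathcal W_i}$, and $(\rho,S)$ is the induced representation of $E$ induced by $\sigma|_{\mathcal W}$; in each formula the term $P_{\mathcal W_i}^\perp$ acts on the first summand of the range of $U'$ (resp. $U$) and the term containing $\widetilde S$ acts on the second summand.
   Context: All $*$-homomorphisms and representations are nondegenerate. A $C^*$-correspondence over a $C^*$-algebra $\mathcal A$ is a Hilbert $\mathcal A$-module $F$ with a left action of $\mathcal A$ given by a $*$-homomorphism into the adjointable operators on $F$. Tensor products are interior tensor products, $F^{\otimes 0}=\mathcal A$, and for a representation $\sigma$ of $\mathcal A$ on a Hilbert space $\mathcal H$, $F\otimes\mathcal H=F\otimes_\sigma\mathcal H$ has inner product $\langle\xi_1\otimes h_1,\xi_2\otimes h_2\rangle=\langle h_1,\sigma(\langle\xi_1,\xi_2\rangle)h_2\rangle$; $\mathcal A\otimes\mathcal H$ is identified with $\mathcal H$. A (completely bounded) covariant representation of $F$ on $\mathcal H$ is a pair $(\sigma,V)$ with $\sigma:\mathcal A\to B(\mathcal H)$ a representation and $V:F\to B(\mathcal H)$ linear, completely bounded, with $V(b\xi a)=\sigma(b)V(\xi)\sigma(a)$. Put $\widetilde V:F\otimes\mathcal H\to\mathcal H$, $\widetilde V(\xi\otimes h)=V(\xi)h$, and $\widetilde V_n(\xi_1\otimes\cdots\otimes\xi_n\otimes h)=V(\xi_1)\cdots V(\xi_n)h$ on $F^{\otimes n}\otimes\mathcal H$ ($\widetilde V_0=I$). It is isometric if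 $V(\eta)^*V(\xi)=\sigma(\langle\eta,\xi\rangle)$ (equivalently $\widetilde V$ is an isometry), and pure if $\widetilde V_n\widetilde V_n^*\to0$ strongly. The Fock space is $\mathcal F(F)=\bigoplus_{n\ge0}F^{\otimes n}$ with the natural left action $\phi_\infty$. For a representation $\pi$ of $\mathcal A$ on $\mathcal K$, the induced representation $(\rho,S)$ of $F$ on $\mathcal F(F)\otimes_\pi\mathcal K$ is $\rho(a)=\phi_\infty(a)\otimes I$, $S(\xi)(\eta\otimes k)=(\xi\otimes\eta)\otimes k$. $\mathcal K$ is identified with the $n=0$ summand of $\mathcal F(F)\otimes\mathcal K$. If $(\sigma,V)$ is pure isometric with $\mathcal W=\mathcal H\ominus\widetilde V(F\otimes\mathcal H)$, then $\mathcal H=\bigoplus_n\widetilde V_n(F^{\otimes n}\otimes\mathcal W)$, and the Wold–von Neumann decomposition is the unitary $\Pi_V:\mathcal H\to\mathcal F(F)\otimes\mathcal W$, $\Pi_V\widetilde V_n(\eta_n\otimes w)=\eta_n\otimes w$; it intertwines $(\sigma,V)$ with the representation $(\rho,S)$ induced by $\sigma|_{\mathcal W}$. A product system $\mathbb E$ over $\mathbb N_0^2$ consists of $C^*$-correspondences $E_1,E_2$ over $\mathcal A$ and a unitary isomorphism $t_{2,1}:E_2\otimes E_1\to E_1\otimes E_2$; $t_{1,2}=t_{2,1}^{-1}$, $E:=E_1\otimes E_2$. A covariant representation of $\mathbb E$ on $\mathcal H$ is a triple $(\sigma,V^{(1)},V^{(2)})$ where each $(\sigma,V^{(i)})$ is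 a covariant representation of $E_i$ and $\widetilde V^{(1)}(I_{E_1}\otimes\widetilde V^{(2)})=\widetilde V^{(2)}(I_{E_2}\otimes\widetilde V^{(1)})(t_{1,2}\otimes I_{\mathcal H})$; it is isometric if both $(\sigma,V^{(i)})$ are. Then $\widetilde V:=\widetilde V^{(1)}(I_{E_1}\otimes\widetilde V^{(2)})$ defines an isometric covariant representation $(\sigma,V)$ of $E$, and the triple is called pure if $(\sigma,V)$ is pure. Put $\mathcal W=\mathcal H\ominus\widetilde V(E\otimes\mathcal H)$ and $\mathcal W_i=\mathcal H\ominus\widetilde V^{(i)}(E_i\otimes\mathcal H)$ (all $\sigma$-invariant); one has $\mathcal W=\mathcal W_1\oplus\widetilde V^{(1)}(E_1\otimes\mathcal W_2)=\widetilde V^{(2)}(E_2\otimes\mathcal W_1)\oplus\mathcal W_2$. BCL-representation: for a pure isometric triple, it is $(\rho,M_{\Theta_1},M_{\Theta_2})$ on $\mathcal F(E)\otimes\mathcal W$, where $\rho(a)=\phi_\infty(a)\otimes I_{\mathcal W}$, $M_{\Theta_i}(\xi_i)=\Pi_VV^{(i)}(\xi_i)\Pi_V^*$ for $\xi_i\in E_i$, $\Theta_i:E_i\to B(\mathcal W,\mathcal F(E)\otimes\mathcal W)$ is $\Theta_i(\xi_i)=M_{\Theta_i}(\xi_i)|_{\mathcal W}$, and $\widetilde\Theta_i:E_i\otimes\mathcal W\to\mathcal F(E)\otimes\mathcal W$ is $\widetilde\Theta_i(\xi\otimes w)=\Theta_i(\xi)w$. *)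

(* Defs.v *)
From HB Require Import structures.
From mathcomp Require Import all_boot all_order all_algebra.
From mathcomp Require Import complex.
From mathcomp Require Import boolp classical_sets reals topology normedtype.

Set Implicit Arguments.
Unset Strict Implicit.
Unset Printing Implicit Defensive.

Import Order.TTheory GRing.Theory Num.Theory.
Import numFieldNormedType.Exports.

Local Open Scope classical_set_scope.
Local Open Scope complex_scope.
Local Open Scope ring_scope.

(* Inner products are conjugate-linear in the first argument and linear in the
   second. Norms of normed modules over R[i] take their values in R[i]. *)
HB.mixin Record isHilbert (R : realType) H & CompleteNormedModule R[i] H := {
  dot : H -> H -> R[i];
  dot_linear : forall x, linear_for *%R (dot x);
  dotC : forall x y, dot y x = (dot x y)^*;
  dot_norm : forall x, dot x x = `|x| ^+ 2 }.

#[short(type="hilbertType")]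
HB.structure Definition Hilbert (R : realType) :=
  {H of isHilbert R H & CompleteNormedModule R[i] H}.

(* The algebra need not have a unit. *)
HB.mixin Record isCStarAlgebra (R : realType) A & CompleteNormedModule R[i] A := {
  cmul : A -> A -> A;
  cadj : A -> A;
  cmulA : associative cmul;
  cmul_linearl : forall b, linear (cmul^~ b);
  cmul_linearr : forall a, linear (cmul a);
  cadjK : involutive cadj;
  cadj_antilinear : forall (k : R[i]) a b,
    cadj (k *: a + b) = k^* *: cadj a + cadj b;
  cadjM : forall a b, cadj (cmul a b) = cmul (cadj b) (cadj a);
  normcM : forall a b, `|cmul a b| <= `|a| * `|b|;
  normcC : forall a, `|cmul (cadj a) a| = `|a| ^+ 2 }.

#[short(type="cstarAlgType")]
HB.structure Definition CStarAlgebra (R : realType) :=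
  {A of isCStarAlgebra R A & CompleteNormedModule R[i] A}.

Definition bounded_op (R : realType) (X Y : normedModType R[i]) (f : X -> Y) :=
  linear f /\ continuous f.

(* A Hilbert space together with a representation, not necessarily
   nondegenerate, of A on it. *)
HB.mixin Record isRep (R : realType) (A : cstarAlgType R) H & Hilbert R H := {
  act : A -> H -> H;
  act_bounded : forall a, bounded_op (act a);
  act_linear : forall x, linear (act^~ x);
  actM : forall a b x, act (cmul a b) x = act a (act b x);
  act_adj : forall a x y, dot (act a x) y = dot x (act (cadj a) y) }.

#[short(type="repType")]
HB.structure Definition Rep (R : realType) (A : cstarAlgType R) :=
  {H of isRep R A H & Hilbert R H}.

HB.mixin Record isHilbertModule (R : realType) (A : cstarAlgType R) F
    & CompleteNormedModule R[i] F := {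
  rmod : F -> A -> F;
  hdot : F -> F -> A;
  rmod_linearl : forall a, linear (rmod^~ a);
  rmod_linearr : forall x, linear (rmod x);
  rmodM : forall x a b, rmod x (cmul a b) = rmod (rmod x a) b;
  hdot_linear : forall x, linear (hdot x);
  hdotMr : forall x y a, hdot x (rmod y a) = cmul (hdot x y) a;
  hdotC : forall x y, hdot y x = cadj (hdot x y);
  hdot_ge0 : forall x, exists b, hdot x x = cmul (cadj b) b;
  hdot_norm : forall x, `|hdot x x| = `|x| ^+ 2 }.

#[short(type="hilbertModType")]
HB.structure Definition HilbertModule (R : realType) (A : cstarAlgType R) :=
  {F of isHilbertModule R A F & CompleteNormedModule R[i] F}.

(* Linearity, right A-linearity and boundedness of lmod a follow from
   adjointability, i.e. from lmod_adj. *)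
HB.mixin Record isCorr (R : realType) (A : cstarAlgType R) F
    & HilbertModule R A F := {
  lmod : A -> F -> F;
  lmod_linear : forall x, linear (lmod^~ x);
  lmodM : forall a b x, lmod (cmul a b) x = lmod a (lmod b x);
  lmod_adj : forall a x y, hdot (lmod a x) y = hdot x (lmod (cadj a) y) }.

#[short(type="corrType")]
HB.structure Definition Corr (R : realType) (A : cstarAlgType R) :=
  {F of isCorr R A F & HilbertModule R A F}.

Section Subspaces.
Variables (R : realType).
Implicit Types (X : normedModType R[i]).

Definition closed_subspace X (K : set X) :=
  [/\ closed K, K 0 & forall (k : R[i]) x y, K x -> K y -> K (k *: x + y)].

Definition closed_span X (S : set X) : set X := smallest (@closed_subspace X) S.

Definition total X (I : Type) (e : I -> X) := closed_span (range e) = setT.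

Definition orth (H : hilbertType R) (S : set H) : set H :=
  [set x | forall y, S y -> dot y x = 0].

(* Adjoints, orthogonal projections and extensions are given by their
   characteristic properties, with value 0 where no such object exists. *)
Definition adj (H K : hilbertType R) (f : H -> K) (y : K) : H :=
  xget 0 [set x | forall z, dot (f z) y = dot z x].

Definition proj (H : hilbertType R) (S : set H) (x : H) : H :=
  xget 0 [set y | S y /\ orth S (x - y)].

(* The bounded operator taking the values f i at the vectors e i; it is unique
   if the family e is total. *)
Definition ext (X Y : normedModType R[i]) (I : Type) (e : I -> X) (f : I -> Y)
  : X -> Y :=
  xget (fun=> 0) [set g | bounded_op g /\ forall i, g (e i) = f i].

End Subspaces.

Section HilbertTheory.
Variables (R : realType) (H : hilbertType R).
Implicit Types x y z : H.

Lemma dotDr x y z : dot x (y + z) = dot x y + dot x z.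
Proof. by have := dot_linear x 1 y z; rewrite scale1r mul1r. Qed.

Lemma dot0r x : dot x 0 = 0.
Proof. by apply: (addrI (dot x 0)); rewrite -dotDr !addr0. Qed.

Lemma dotZr k x y : dot x (k *: y) = k * dot x y.
Proof. by rewrite -[k *: y]addr0 dot_linear dot0r addr0. Qed.

Lemma dotBr x y z : dot x (y - z) = dot x y - dot x z.
Proof. by rewrite dotDr -scaleN1r dotZr mulN1r. Qed.

Lemma dotBl x y z : dot (x - y) z = dot x z - dot y z.
Proof. by rewrite dotC dotBr rmorphB/= -!dotC. Qed.

Lemma dotZl k x y : dot (k *: x) y = k^* * dot x y.
Proof. by rewrite dotC dotZr rmorphM/= -dotC. Qed.

Lemma cauchy_schwarz x y : `|dot x y| <= `|x| * `|y|.
Proof.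
have [->|x0] := eqVneq x 0.
  by rewrite dotC dot0r conjC0 !normr0 mul0r.
have nx0 : `|x| ^+ 2 != 0 by rewrite sqrf_eq0 normr_eq0.
have nx2 : 0 < `|x| ^+ 2 :> R[i] by rewrite exprn_gt0// normr_gt0.
have nxC : (`|x| ^+ 2)^* = `|x| ^+ 2.
  by apply/CrealP; rewrite realE exprn_ge0.
pose c := dot x y / `|x| ^+ 2.
have : 0 <= dot (y - c *: x) (y - c *: x) by rewrite dot_norm exprn_ge0.
have cE : c^* = (dot x y)^* / `|x| ^+ 2.
  by rewrite /c rmorphM/= fmorphV/= nxC.
rewrite dotBr dotZr !dotBl !dotZl (dot_norm y) (dot_norm x) cE divfK//.
rewrite -(dotC x y) subrr mulr0 subr0 subr_ge0 (dotC x y) => h.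
rewrite -(@ler_pXn2r _ 2)// ?nnegrE ?mulr_ge0// exprMn.
rewrite normCK [X in _ <= X]mulrC -ler_pdivrMr//.
by apply: le_trans h; rewrite (mulrC (dot x y)) mulrAC.
Qed.

End HilbertTheory.

Lemma dot_continuous (R : realType) (H : hilbertType R) (x : H) :
  continuous (dot x : H -> R[i]^o).
Proof.
move=> y; apply/cvgrPdist_le => /= e e0.
near=> z.
rewrite -dotBr (le_trans (cauchy_schwarz _ _))//.
rewrite (@le_trans _ _ ((`|x| + 1) * `|y - z|))//.
  by rewrite ler_wpM2r// lerDl.
rewrite -ler_pdivlMl ?ltr_wpDl//.
near: z; apply: cvgr_dist_le => //.
by rewrite mulr_gt0// invr_gt0 ltr_wpDl.
Unshelve. all: by end_near. Qed.

Lemma orth_closed (R : realType) (H : hilbertType R) (S : set H) :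
  closed_subspace (orth S).
Proof.
split.
- have -> : orth S = \bigcap_(y in S) (dot y : H -> R[i]^o) @^-1` [set 0].
    by apply/seteqP; split=> x.
  apply: closed_bigI => y Sy; apply: closed_comp.
    by move=> x _; exact: dot_continuous.
  exact: accessible_closed_set1 (hausdorff_accessible (@norm_hausdorff _ _)) _.
- by move=> y _; exact: dot0r.
- by move=> k x y Sx Sy z Sz; rewrite dot_linear Sx// Sy// mulr0 addr0.
Qed.

(* A closed invariant subspace of a representation space, with the restricted
   inner product and the restricted representation. *)
Section SubRepresentation.
Variables (R : realType) (A : cstarAlgType R) (H : repType A) (K : set H).

Definition closed_invariant :=
  closed_subspace K /\ forall a x, K x -> K (act a x).

Definition subrep_of (hK : closed_invariant) := {x : H | x \in K}.

Variable hK : closed_invariant.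
Local Notation W := (subrep_of hK).

Definition subrep_val (x : W) : H := sval x.

HB.instance Definition _ := [isSub of W for subrep_val].
HB.instance Definition _ := [Choice of W by <:].

Fact subrep_submod : GRing.subsemimod_closed (mem K).
Proof.
case: hK => -[_ K0 KL] _; split; first split.
- by rewrite inE.
- move=> x y; rewrite !inE => Kx Ky.
  by have := KL 1 _ _ Kx Ky; rewrite scale1r.
- move=> k x; rewrite !inE => Kx.
  by have := KL k _ _ Kx K0; rewrite addr0.
Qed.
HB.instance Definition _ :=
  GRing.SubChoice_isSubLmodule.Build R[i] H (mem K) W subrep_submod.

Let vL k (x y : W) : val (k *: x + y) = k *: val x + val y.
Proof. by []. Qed.

Definition subrep_norm (x : W) : R[i] := `|val x|.

Fact subrep_normD x y : subrep_norm (x + y) <= subrep_norm x + subrep_norm y.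
Proof. exact: ler_normD. Qed.
Fact subrep_normZ k x : subrep_norm (k *: x) = `|k| * subrep_norm x.
Proof. exact: normrZ. Qed.
Fact subrep_norm_eq0 x : subrep_norm x = 0 -> x = 0.
Proof. by move=> /eqP; rewrite normr_eq0 => /eqP x0; exact: val_inj. Qed.
HB.instance Definition _ :=
  @Lmodule_isNormed.Build R[i] W subrep_norm
    subrep_normD subrep_normZ subrep_norm_eq0.

Fact subrep_complete (F : set_system W) : ProperFilter F -> cauchy F -> cvg F.
Proof.
move=> FF /cauchy_ballP cF.
have cG : cauchy (val @ F : set_system H).
  apply/cauchy_ballP => e e0.
  have [[P Q] [/= FP FQ] PQ] := cF e e0.
  exists (val @` P, val @` Q).
    by split; [apply: filterS FP|apply: filterS FQ] => x ?; exists x.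
  move=> [_ _] [[x Px <-] [y Qy <-]].
  have := PQ (x, y) (conj Px Qy).
  by rewrite /= -!ball_normE.
have /cvg_ex[l Fl] : cvg (val @ F : set_system H) by exact: cauchy_cvg cG.
have Kl : K l.
  case: hK => -[cK _ _] _; apply: (closed_cvg K cK _ _ Fl).
  by apply: nearW => x; have := valP x; rewrite inE.
apply/cvg_ex; exists (Sub l (mem_set Kl) : W).
apply/cvgrPdist_lt => e e0.
by move/cvgrPdist_lt: Fl => /(_ e e0).
Qed.
HB.instance Definition _ := Uniform_isComplete.Build W subrep_complete.

Definition subrep_dot (x y : W) : R[i] := dot (val x) (val y).

Fact subrep_dot_linear x : linear_for *%R (subrep_dot x).
Proof. by move=> k y z; exact: dot_linear. Qed.
Fact subrep_dotC x y : subrep_dot y x = (subrep_dot x y)^*.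
Proof. exact: dotC. Qed.
Fact subrep_dot_norm x : subrep_dot x x = `|x| ^+ 2.
Proof. exact: dot_norm. Qed.
HB.instance Definition _ :=
  isHilbert.Build R W subrep_dot_linear subrep_dotC subrep_dot_norm.

Definition subrep_act (a : A) (x : W) : W :=
  Sub (act a (val x)) (mem_set (hK.2 a _ (set_mem (valP x)))).

Fact subrep_act_bounded a : bounded_op (subrep_act a).
Proof.
have [al ac] := act_bounded a :> bounded_op (act a : H -> H).
split; first by move=> k x y; apply: val_inj; exact: al.
move=> x; apply/(@cvgrPdist_lt _ W _ (nbhs x)) => e e0.
have /cvgrPdist_lt/(_ e e0)/nbhs_ballP[d d0 dP] := ac (val x).
apply/nbhs_ballP; exists d => // y xy; apply: dP.
by move: xy; rewrite -!ball_normE.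
Qed.
Fact subrep_act_linear x : linear (subrep_act^~ x).
Proof. by move=> k a b; apply: val_inj; exact: act_linear. Qed.
Fact subrep_actM a b x :
  subrep_act (cmul a b) x = subrep_act a (subrep_act b x).
Proof. by apply: val_inj; exact: actM. Qed.
Fact subrep_act_adj a x y :
  dot (subrep_act a x) y = dot x (subrep_act (cadj a) y).
Proof. exact: act_adj. Qed.
HB.instance Definition _ := isRep.Build R A W
  subrep_act_bounded subrep_act_linear subrep_actM subrep_act_adj.

End SubRepresentation.

(* A as a correspondence over itself. *)
Section Regular.
Variables (R : realType) (A : cstarAlgType R).

Definition regular : Type := A.
HB.instance Definition _ := CompleteNormedModule.on regular.

Let rdot (a b : regular) : A := cmul (cadj (a : A)) (b : A).
Let rrmod (a : regular) (b : A) : regular := cmul (a : A) b.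
Let rlmod (a : A) (b : regular) : regular := cmul a (b : A).

Fact regular_rmod_linearl a : linear (rrmod^~ a).
Proof. exact: cmul_linearl. Qed.
Fact regular_rmod_linearr x : linear (rrmod x).
Proof. exact: cmul_linearr. Qed.
Fact regular_rmodM x a b : rrmod x (cmul a b) = rrmod (rrmod x a) b.
Proof. exact: cmulA. Qed.
Fact regular_dot_linear x : linear (rdot x).
Proof. exact: cmul_linearr. Qed.
Fact regular_dotMr x y a : rdot x (rrmod y a) = cmul (rdot x y) a.
Proof. exact: cmulA. Qed.
Fact regular_dotC x y : rdot y x = cadj (rdot x y).
Proof. by rewrite /rdot cadjM cadjK. Qed.
Fact regular_dot_ge0 x : exists b, rdot x x = cmul (cadj b) b.
Proof. by exists x. Qed.
Fact regular_dot_norm x : `|rdot x x| = `|x| ^+ 2.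
Proof. exact: normcC. Qed.
HB.instance Definition _ := isHilbertModule.Build R A regular
  regular_rmod_linearl regular_rmod_linearr regular_rmodM regular_dot_linear
  regular_dotMr regular_dotC regular_dot_ge0 regular_dot_norm.

Fact regular_lmod_linear x : linear (rlmod^~ x).
Proof. exact: cmul_linearl. Qed.
Fact regular_lmodM a b x : rlmod (cmul a b) x = rlmod a (rlmod b x).
Proof. by rewrite /rlmod cmulA. Qed.
Fact regular_lmod_adj a x y : hdot (rlmod a x) y = hdot x (rlmod (cadj a) y).
Proof. by rewrite /hdot/= /rdot /rlmod cadjM cmulA. Qed.
HB.instance Definition _ := isCorr.Build R A regular
  regular_lmod_linear regular_lmodM regular_lmod_adj.

End Regular.

Section Realization.
Variables (R : realType) (A : cstarAlgType R).

(* The interior tensor product of F and G: the Hilbert module in which the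
   elementary tensors have the inner products of it_dot and span a dense
   subspace. Bilinearity, A-balancedness and the right action on elementary
   tensors follow from it_dot. *)
Record itensor (F G : corrType A) := ITensor {
  it_sort :> corrType A;
  it_map : F -> G -> it_sort;
  it_dot : forall x1 y1 x2 y2, hdot (it_map x1 y1) (it_map x2 y2) =
    hdot y1 (lmod (hdot x1 x2) y2);
  it_total : total (fun p : F * G => it_map p.1 p.2);
  it_lmod : forall a x y, lmod a (it_map x y) = it_map (lmod a x) y }.

(* The Hilbert space F (x)_sigma K, where sigma is the representation carried
   by K; it carries the representation a |-> phi(a) (x) I. *)
Record htensor (F : corrType A) (K : repType A) := HTensor {
  ht_sort :> repType A;
  ht_map : F -> K -> ht_sort;
  ht_dot : forall x1 h1 x2 h2, dot (ht_map x1 h1) (ht_map x2 h2) =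
    dot h1 (act (hdot x1 x2) h2);
  ht_total : total (fun p : F * K => ht_map p.1 p.2);
  ht_act : forall a x h, act a (ht_map x h) = ht_map (lmod a x) h }.

Record direct_sum (G : nat -> corrType A) := DirectSum {
  ds_sort :> corrType A;
  ds_in : forall n, G n -> ds_sort;
  ds_dot : forall n (x y : G n), hdot (ds_in x) (ds_in y) = hdot x y;
  ds_orth : forall n m (x : G n) (y : G m), n <> m ->
    hdot (ds_in x) (ds_in y) = 0;
  ds_total : total (fun p : {n & G n} => ds_in (projT2 p));
  ds_lmod : forall a n (x : G n), lmod a (ds_in x) = ds_in (lmod a x) }.

(* Interior tensor products and direct sums are determined by the above data up
   to a unique unitary isomorphism respecting ht_map, it_map and ds_in; a
   realization is a choice of a representative in each isomorphism class. *)
Record realization := Realization {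
  tens : forall F G, itensor F G;
  htens : forall F K, htensor F K;
  dsum : forall G, direct_sum G }.

Definition nondegenerate (H : repType A) :=
  total (fun p : A * H => act p.1 p.2).

Definition nondegenerate_corr (F : corrType A) :=
  total (fun p : A * F => lmod p.1 p.2).

(* F is an operator space through the identification of an n x n matrix xi
   over F with the operator a |-> xi a from A^n to F^n; the hypothesis on r
   below says that the norm of xi in M_n(F) is at most r. *)
Definition completely_bounded (F : corrType A) (H : hilbertType R)
    (V : F -> H -> H) :=
  exists2 C : R[i], 0 <= C &
  forall n (xi : 'I_n -> 'I_n -> F) (r : R[i]), 0 <= r ->
    (forall a : 'I_n -> A,
       `|\sum_i hdot (\sum_j rmod (xi i j) (a j)) (\sum_j rmod (xi i j) (a j))|
       <= r ^+ 2 * `|\sum_j cmul (cadj (a j)) (a j)|) ->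
    forall h : 'I_n -> H,
      \sum_i `|\sum_j V (xi i j) (h j)| ^+ 2 <=
      (C * r) ^+ 2 * \sum_j `|h j| ^+ 2.

Record cov_rep (F : corrType A) (H : repType A) (V : F -> H -> H) : Prop := {
  cov_bounded : forall x, bounded_op (V x);
  cov_linear : forall h, linear (V^~ h);
  cov_cb : completely_bounded V;
  cov_cov : forall b x a h, V (lmod b (rmod x a)) h = act b (V x (act a h)) }.

Definition isometric (F : corrType A) (H : repType A) (V : F -> H -> H) :=
  forall x y h k, dot (V y h) (V x k) = dot h (act (hdot y x) k).

End Realization.

Section Operators.
Variables (R : realType) (A : cstarAlgType R) (T : realization A).
Implicit Types (F G : corrType A) (H K : repType A).

(* For V : F -> B(H), the operator tilde V : F (x) H -> H. *)
Definition tilde F H K (V : F -> H -> K) : htens T F H -> K :=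
  ext (fun p => ht_map (htens T F H) p.1 p.2) (fun p : F * H => V p.1 p.2).

(* t (x) f *)
Definition tensop F G H K (t : F -> G) (f : H -> K) : htens T F H -> htens T G K :=
  tilde (fun x h => ht_map (htens T G K) (t x) (f h)).

(* (F (x) G) (x) H -> F (x) (G (x) H) and its inverse. *)
Definition assoc F G H : htens T (tens T F G) H -> htens T F (htens T G H) :=
  ext (fun p => ht_map (htens T (tens T F G) H)
                  (it_map (tens T F G) p.1.1 p.1.2) p.2)
      (fun p : F * G * H => ht_map (htens T F (htens T G H)) p.1.1
                              (ht_map (htens T G H) p.1.2 p.2)).

Definition assocV F G H : htens T F (htens T G H) -> htens T (tens T F G) H :=
  ext (fun p => ht_map (htens T F (htens T G H)) p.1.1
                  (ht_map (htens T G H) p.1.2 p.2))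
      (fun p : F * G * H => ht_map (htens T (tens T F G) H)
                              (it_map (tens T F G) p.1.1 p.1.2) p.2).

(* The subspace F (x) K of F (x) H, for K a subspace of H. *)
Definition tset F H (K : set H) : set (htens T F H) :=
  closed_span [set ht_map (htens T F H) x h | x in setT & h in K].

Fixpoint tpow F n : corrType A :=
  if n is m.+1 then (tens T F (tpow F m) : corrType A)
  else (regular A : corrType A).

Fixpoint tilde_pow F H (V : F -> H -> H) n : htens T (tpow F n) H -> H :=
  match n return htens T (tpow F n) H -> H with
  | 0 => tilde (fun (a : regular A) h => act (a : A) h)
  | m.+1 =>
    ext (fun p => ht_map (htens T (tpow F m.+1) H)
                    (it_map (tens T F (tpow F m)) p.1.1 p.1.2) p.2)
        (fun p : F * tpow F m * H =>
           V p.1.1 (tilde_pow V (ht_map (htens T (tpow F m) H) p.1.2 p.2)))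
  end.

Definition pure F H (V : F -> H -> H) :=
  forall h : H,
    tilde_pow V (adj (tilde_pow V (n := n)) h) @[n --> \oo] --> (0 : H).

Definition fock F : corrType A := dsum T (tpow F).

Section Induced.
Variables (F : corrType A) (K : repType A).
Local Notation FK := (htens T (fock F) K).

(* S(xi) for the representation (rho, S) of F induced by the representation on
   K; rho is the representation carried by F(F) (x) K. *)
Definition ind_shift (x : F) : FK -> FK :=
  ext (fun p => ht_map FK (ds_in (dsum T (tpow F)) (projT2 p.1)) p.2)
      (fun p : {n & tpow F n} * K =>
         ht_map FK (ds_in (dsum T (tpow F)) (n := (projT1 p.1).+1)
           (it_map (tens T F (tpow F (projT1 p.1))) x (projT2 p.1))) p.2).

(* The embedding of K as the summand F^0 (x) K = A (x) K, in which a (x) k is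
   identified with the vector a k. *)
Definition vac : K -> FK :=
  ext (fun p => act p.1 p.2)
      (fun p : A * K => ht_map FK (ds_in (dsum T (tpow F)) (n := 0%N) (p.1 : regular A)) p.2).

End Induced.

End Operators.

Arguments tset {R A} T F {H} K.

Section OperatorTheory.
Variables (R : realType) (A : cstarAlgType R) (T : realization A).

Lemma closed_span_ind (X : normedModType R[i]) (S P : set X) :
  closed_span S = setT -> closed_subspace P -> S `<=` P -> forall x, P x.
Proof.
by move=> ST cP SP x; have := I : [set: X] x; rewrite -ST; apply.
Qed.

Lemma bounded_op_eq_closed (X Y : normedModType R[i]) (f g : X -> Y) :
  bounded_op f -> bounded_op g -> closed_subspace [set x | f x = g x].
Proof.
move=> [fl fc] [gl gc].
have lin0 (h : X -> Y) : linear h -> h 0 = 0.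
  move=> hl; have := hl 1 0 0; rewrite !scale1r addr0 => h0.
  by apply: (addrI (h 0)); rewrite -h0 addr0.
split.
- have -> : [set x | f x = g x] = (f \- g) @^-1` [set 0].
    apply/seteqP; split=> x /=; first by move=> ->; rewrite subrr.
    by move/eqP; rewrite subr_eq0 => /eqP.
  apply: closed_comp; first by move=> x _; apply: cvgB; [exact: fc|exact: gc].
  exact: accessible_closed_set1 (hausdorff_accessible (@norm_hausdorff _ _)) _.
- by rewrite /= !lin0.
- by move=> k x y /= fx fy; rewrite fl gl fx fy.
Qed.

Lemma bounded_op_comp (X Y Z : normedModType R[i]) (f : X -> Y) (g : Y -> Z) :
  bounded_op f -> bounded_op g -> bounded_op (g \o f).
Proof.
move=> [fl fc] [gl gc]; split; first by move=> k x y /=; rewrite fl gl.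
by move=> x; apply: continuous_comp; [exact: fc|exact: gc].
Qed.

Lemma ext_equivariant (H K : repType A) I (e : I -> H) (f : I -> K) a :
  total e -> (forall i, exists2 j, act a (e i) = e j & act a (f i) = f j) ->
  forall x, ext e f (act a x) = act a (ext e f x).
Proof.
move=> te ef x; rewrite /ext.
case: xgetP => [g _ [gb ge]|_].
  apply: (closed_span_ind te (P := [set x | g (act a x) = act a (g x)])).
    apply: bounded_op_eq_closed.
      exact: (bounded_op_comp (act_bounded a) gb).
    exact: (bounded_op_comp gb (act_bounded a)).
  by move=> _ [i _ <-] /=; have [j ej fj] := ef i; rewrite ej !ge fj.
have := (act_bounded a : bounded_op (act a : K -> K)).1 1 0 0.
rewrite !scale1r addr0 => a0.
by apply: (addrI (act a 0)); rewrite -a0 addr0.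
Qed.

Lemma tensop_equivariant (F G : corrType A) (H K : repType A) (t : F -> G) (f : H -> K) a :
  (forall x, t (lmod a x) = lmod a (t x)) ->
  forall z : htens T F H, tensop t f (act a z) = act a (tensop t f z).
Proof.
move=> tE; apply: ext_equivariant; first exact: ht_total.
by move=> [x h]; exists (lmod a x, h); rewrite ht_act ?tE.
Qed.

Lemma tilde_equivariant (F : corrType A) (H K : repType A) (V : F -> H -> K) a :
  (forall x h, V (lmod a x) h = act a (V x h)) ->
  forall z : htens T F H, tilde V (act a z) = act a (tilde V z).
Proof.
move=> VE; apply: ext_equivariant; first exact: ht_total.
by move=> [x h]; exists (lmod a x, h); rewrite ?ht_act ?VE.
Qed.

Lemma lmod_rmod (F : corrType A) a (x : F) b :
  lmod a (rmod x b) = rmod (lmod a x) b.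
Proof.
apply/eqP; rewrite -subr_eq0 -normr_eq0 -sqrf_eq0 -hdot_norm.
set u := _ - _.
have := hdot_linear u (- 1) (rmod (lmod a x) b) (lmod a (rmod x b)).
rewrite !scaleN1r [- rmod _ _ + _]addrC -/u => ->.
have adjr y : hdot u (lmod a y) = hdot (lmod (cadj a) u) y.
  by rewrite lmod_adj cadjK.
by rewrite adjr !hdotMr adjr addNr normr0.
Qed.

Lemma cov_lmod (F : corrType A) (H : repType A) (V : F -> H -> H) :
  nondegenerate H -> cov_rep V -> isometric V ->
  forall a x h, V (lmod a x) h = act a (V x h).
Proof.
move=> Hn Vc Vi a x.
have Vr y b h : V (rmod y b) h = V y (act b h).
  apply/eqP; rewrite -subr_eq0 -normr_eq0 -sqrf_eq0 -dot_norm.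
  rewrite dotBr !dotBl !Vi !hdotMr.
  by rewrite !actM subrr.
apply: (closed_span_ind Hn (P := [set h | V (lmod a x) h = act a (V x h)])).
  apply: bounded_op_eq_closed; first exact: cov_bounded.
  exact: (bounded_op_comp (cov_bounded Vc x) (act_bounded a)).
move=> _ [[b h] _ <-] /=.
by rewrite -[LHS]Vr -(cov_cov Vc) lmod_rmod.
Qed.

End OperatorTheory.

Section ProductSystem.
Variables (R : realType) (A : cstarAlgType R) (T : realization A).

Record product_system := ProductSystem {
  ps1 : corrType A;
  ps2 : corrType A;
  ps_nondeg1 : nondegenerate_corr ps1;
  ps_nondeg2 : nondegenerate_corr ps2;
  t21 : tens T ps2 ps1 -> tens T ps1 ps2;
  t12 : tens T ps1 ps2 -> tens T ps2 ps1;
  t21_linear : linear t21;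
  t21_hdot : forall x y, hdot (t21 x) (t21 y) = hdot x y;
  t21_lmod : forall a x, t21 (lmod a x) = lmod a (t21 x);
  t21_rmod : forall x a, t21 (rmod x a) = rmod (t21 x) a;
  t21K : cancel t21 t12;
  t12K : cancel t12 t21 }.

Definition ps (E : product_system) : corrType A := tens T (ps1 E) (ps2 E).

(* (sigma, V1, V2) on H, where sigma is the representation carried by H. *)
Record isometric_rep (E : product_system) (H : repType A) := IsometricRep {
  rep_nondeg : nondegenerate H;
  V1 : ps1 E -> H -> H;
  V2 : ps2 E -> H -> H;
  V1_cov : cov_rep V1;
  V2_cov : cov_rep V2;
  V1_isom : isometric V1;
  V2_isom : isometric V2;
  V12 : forall x : htens T (ps E) H,
    tilde V1 (tensop idfun (tilde V2) (assoc x)) =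
    tilde V2 (tensop idfun (tilde V1) (assoc (tensop (@t12 E) idfun x))) }.

End ProductSystem.

Section DirectSums.
Variables (R : realType).

Definition orth_dsum (H : hilbertType R) (K K1 K2 : set H) :=
  (forall x y, K1 x -> K2 y -> dot x y = 0) /\
  K = [set x + y | x in K1 & y in K2].

Definition components (H : hilbertType R) (K1 K2 : set H) (x : H) : H * H :=
  (proj K1 x, proj K2 x).

(* f restricts to a unitary from D onto C, for subspaces D and C of orthogonal
   direct sums of two Hilbert spaces. *)
Definition unitary_on (X1 X2 Y1 Y2 : hilbertType R) (D : set (X1 * X2))
    (f : X1 * X2 -> Y1 * Y2) (C : set (Y1 * Y2)) :=
  [/\ forall (k : R[i]) p q, D p -> D q -> f (k *: p + q) = k *: f p + f q,
      forall p q, D p -> D q ->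
        dot (f p).1 (f q).1 + dot (f p).2 (f q).2 = dot p.1 q.1 + dot p.2 q.2 &
      f @` D = C].

End DirectSums.

Section BCL.
Variables (R : realType) (A : cstarAlgType R) (T : realization A).
Variables (E : product_system T) (H : repType A) (V : isometric_rep E H).
Local Notation E1 := (ps1 E).
Local Notation E2 := (ps2 E).
Local Notation V1 := (V1 V).
Local Notation V2 := (V2 V).

(* tilde V on E1 (x) (E2 (x) H), and the representation of E it defines. *)
Definition tildeV : htens T E1 (htens T E2 H) -> H :=
  tilde V1 \o tensop idfun (tilde V2).

Definition VE (z : ps E) (h : H) : H := tildeV (assoc (ht_map (htens T (ps E) H) z h)).

Definition pure_rep := pure T VE.

(* The wandering subspaces, as subspaces of H. *)
Definition Wset : set H := orth (range tildeV).
Definition W1 : set H := orth (range (tilde V1 : htens T E1 H -> H)).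
Definition W2 : set H := orth (range (tilde V2 : htens T E2 H -> H)).

Fact Wset_invariant : closed_invariant Wset.
Proof.
split; first exact: orth_closed.
move=> a x Wx _ [y _ <-]; rewrite dotC act_adj -dotC.
rewrite -[act _ _](_ : tildeV (act (cadj a) y) = _); first exact: Wx.
rewrite /tildeV/= tensop_equivariant// tilde_equivariant//.
by apply: cov_lmod; [exact: (rep_nondeg V)|exact: V1_cov|exact: V1_isom].
Qed.

(* W with the restriction of sigma. *)
Definition W : repType A := subrep_of Wset_invariant.

Definition inW : W -> H := val.

(* Adjoint of the inclusion: the orthogonal projection of H onto W. *)
Definition toW : H -> W := adj inW.

Definition PW (K : set H) : W -> W := proj [set w | K (inW w)].

Definition PWperp (K : set H) (w : W) : W := w - PW K w.

Local Notation FW := (htens T (fock T (ps E)) W).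

(* The Wold-von Neumann unitary. *)
Definition Pi : H -> FW :=
  ext (fun p => tilde_pow VE (ht_map (htens T (tpow T (ps E) (projT1 p.1)) H)
                                (projT2 p.1) (inW p.2)))
      (fun p : {n & tpow T (ps E) n} * W =>
         ht_map FW (ds_in (dsum T (tpow T (ps E))) (projT2 p.1)) p.2).

(* W as the n = 0 summand of F(E) (x) W. *)
Definition vacW : W -> FW := @vac _ _ T (ps E) W.

Definition M1 (x : E1) : FW -> FW := Pi \o V1 x \o adj Pi.
Definition M2 (x : E2) : FW -> FW := Pi \o V2 x \o adj Pi.
Definition Theta1 (x : E1) (w : W) : FW := M1 x (vacW w).
Definition Theta2 (x : E2) (w : W) : FW := M2 x (vacW w).

Definition tildeS : htens T (ps E) FW -> FW := tilde (@ind_shift _ _ T (ps E) W).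

(* The block diagonal operator with entries tilde VF and I (x) (tilde VG)^*, the
   target of the latter being F (x) (G (x) H) = (F (x) G) (x) H. *)
Section Blocks.
Variables (F G : corrType A) (VF : F -> H -> H) (VG : G -> H -> H).

Definition block (p : htens T F H * htens T F H) : H * htens T (tens T F G) H :=
  (tilde VF p.1, assocV (tensop idfun (adj (tilde VG : htens T G H -> H)) p.2)).

End Blocks.

Definition U' := block V1 V2.
Definition U := block V2 V1.

End BCL.

Arguments inW {R A T E H} V _.
Arguments t21 {R A T} p _.
Arguments t12 {R A T} p _.
Arguments Theta1 {R A T E H} V x w.
Arguments Theta2 {R A T E H} V x w.
Arguments toW {R A T E H} V _.

(* Main.v *)
From mathcomp Require Import all_boot all_order all_algebra.
From mathcomp Require Import complex.
From mathcomp Require Import boolp classical_sets reals topology normedtype.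
From mathcomp Require Import ring.
Require Import Defs.

(* Since the tilde operators are isometries, W = W_2 (+) V2~(E2 (x) W_1), and
   tensoring with E1 gives the domain decomposition of U'. For z = p + q in
   E1 (x) W, with p in E1 (x) W_2 and q = (I (x) V2~) r, one has
   V1~ z = V1~ p + V~ r. The vector V1~ p lies in W and is orthogonal to W_1,
   so the Wold unitary Pi sends it into the vacuum summand, while r lies in
   E (x) W_1 and Pi V~ = S~ (I (x) Pi). Exchanging the roles of E1 and E2
   gives the second formula, because V~ (t21 (x) I) = V2~ (I (x) V1~).
   Purity enters only through the unitarity of Pi. *)

Set Implicit Arguments.
Unset Strict Implicit.
Unset Printing Implicit Defensive.

Import Order.TTheory GRing.Theory Num.Theory.
Import numFieldNormedType.Exports.

Local Open Scope classical_set_scope.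
Local Open Scope complex_scope.
Local Open Scope ring_scope.

(** The operators of the statement are picked by [ext], [adj] and [proj], which return 0 when
    nothing with the required property exists, so every operator formula is preceded by an existence
    proof. For isometries existence can be read off from inner products on a total family;
    [tilde V], [assoc], the powers of [V] and [Pi] are all handled in this way. The maps that are
    not isometric (tensors with an adjoint, a single shift, [t] tensored with a projection) are
    written in terms of isometries, their adjoints and the maps [h |-> x (x) h]. Adjoints of
    isometries come from projecting onto closed ranges. Elementary tensors must be continuous in the
    module variable as well. This requires a bound on [act a h] that is linear in the norm of [a],
    which is derived from the C*-identity by a square-root argument phrased without a unit, since
    [A] may lack one. *)

Section GeometricConvergence.
Variable R : realType.

Lemma ex_expr2V_lt (e : R[i]) : 0 < e -> exists n, (2^-1) ^+ n < e.
Proof.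
(* Positivity in [R[i]] forces a zero imaginary part; over the reals the claim follows from
   [1/a < n < 2^n]. *)
case: e => a b; rewrite ltcE /= => /andP[/eqP -> a0].
exists (Num.truncn a^-1).+1.
have -> : (2^-1 : R[i]) ^+ (Num.truncn a^-1).+1 = ((2^-1 : R) ^+ (Num.truncn a^-1).+1)%:C.
  by rewrite rmorphXn fmorphV rmorph_nat.
rewrite ltcR exprVn -[ltRHS]invrK ltf_pV2 ?posrE ?exprn_gt0 ?invr_gt0 //.
apply: (lt_le_trans (truncnS_gt _)).
by rewrite -natrX ler_nat ltnW// ltn_expl.
Qed.

(** The factor 2 is the sum of the geometric series. The limits constructed below all come from this
    criterion: second coordinates of a closed graph, minimizing sequences, and the square-root
    iteration. *)
Lemma geometric_cvg (X : completeNormedModType R[i]) (u : nat -> X) (C : R[i]) :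
  0 <= C -> (forall n, `|u n.+1 - u n| <= C * (2^-1) ^+ n) ->
  exists2 l, u @ \oo --> l & forall n, `|l - u n| <= C * 2 * (2^-1) ^+ n.
Proof.
move=> C0 uC.
have uD n m : `|u (n + m)%N - u n| <= C * 2 * (2^-1) ^+ n.
  (* The factor [1 - 2^-m] records the exact partial sum, which makes the bound stable under
     induction on [m]. *)
  suff : `|u (n + m)%N - u n| <= C * 2 * (2^-1) ^+ n * (1 - (2^-1) ^+ m).
    move=> h; apply: (le_trans h); rewrite ler_piMr//.
      by rewrite !mulr_ge0 ?exprn_ge0 ?invr_ge0.
    by rewrite gerBl exprn_ge0 ?invr_ge0.
  elim: m => [|m ih]; first by rewrite addn0 !subrr mulr0 normr0.
  rewrite (le_trans (ler_distD (u (n + m)%N) _ _))//.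
  rewrite addnS (le_trans (lerD (uC _) ih))//.
  rewrite exprD exprS le_eqVlt; apply/orP; left; apply/eqP.
  by field.
have cu : cauchy (u @ \oo).
  apply/cauchy_exP => e e0.
  have [n ne] : exists n, C * 2 * (2^-1) ^+ n < e.
    have C1 : 0 < C * 2 + 1 by rewrite ltr_wpDl ?mulr_ge0.
    have [n nP] := ex_expr2V_lt (divr_gt0 e0 C1).
    exists n; move: nP; rewrite ltr_pdivlMr// => nP.
    apply: le_lt_trans nP; rewrite mulrC ler_wpM2l ?exprn_ge0 ?invr_ge0//.
    by rewrite lerDl.
  exists (u n), n => // m /= nm.
  rewrite -ball_normE /= distrC -(subnKC nm).
  exact: le_lt_trans ne.
have /cvg_ex[l ul] : cvg (u @ \oo) by exact: cauchy_cvg cu.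
exists l => // n; apply/ler_addgt0Pr => e e0.
have /cvgrPdist_lt/(_ e e0)[N _ NP] := ul.
rewrite (le_trans (ler_distD (u (n + N)%N) _ _))// addrC lerD//.
by apply/ltW/NP; rewrite /= leq_addl.
Qed.

Lemma norm_le_geometric (X : normedZmodType R[i]) (x : X) (C : R[i]) :
  0 <= C -> (forall n, `|x| <= C * (2^-1) ^+ n) -> x = 0.
Proof.
move=> C0 xC; apply/eqP; rewrite -normr_eq0 eq_le normr_ge0 andbT.
apply/ler_addgt0Pr => e e0; rewrite add0r.
have C1 : 0 < C + 1 by rewrite ltr_wpDl.
have [n] := ex_expr2V_lt (divr_gt0 e0 C1).
rewrite ltr_pdivlMr// => /ltW; apply: le_trans; apply: le_trans (xC n) _.
by rewrite mulrC ler_wpM2l ?exprn_ge0 ?invr_ge0// lerDl.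
Qed.

End GeometricConvergence.

(** * Closed subspaces and bounded operators *)

Section Subspaces.
Variable R : realType.
Implicit Types X Y : normedModType R[i].

Lemma linear_fun0 X Y (f : X -> Y) : linear f -> f 0 = 0.
Proof.
move=> fl; have := fl 1 0 0; rewrite !scale1r addr0 => f0.
by apply: (addrI (f 0)); rewrite -f0 addr0.
Qed.

Lemma linear_funB X Y (f : X -> Y) : linear f -> {morph f : x y / x - y}.
Proof.
move=> fl x y; rewrite addrC -scaleN1r fl scaleN1r addrC.
by [].
Qed.

Lemma linear_bounded_op X Y (f : X -> Y) (C : R[i]) :
  linear f -> 0 <= C -> (forall x, `|f x| <= C * `|x|) -> bounded_op f.
Proof.
move=> fl C0 fC; split=> // x; apply/cvgrPdist_lt => e e0.
have C1 : 0 < C + 1 by rewrite ltr_wpDl.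
have /cvgrPdist_lt/(_ _ (divr_gt0 e0 C1)) : y @[y --> x] --> x by exact: cvg_id.
apply: filterS => y; rewrite ltr_pdivlMr// => xy.
rewrite -linear_funB//; apply: le_lt_trans xy.
by rewrite (le_trans (fC _))// mulrC ler_wpM2l// lerDl.
Qed.

Lemma closed_subspaceB X (K : set X) x y :
  closed_subspace K -> K x -> K y -> K (x - y).
Proof. by move=> [_ _ KL] Kx Ky; rewrite addrC -scaleN1r; exact: KL. Qed.

Lemma closed_subspaceD X (K : set X) x y :
  closed_subspace K -> K x -> K y -> K (x + y).
Proof. by move=> [_ _ KL] Kx Ky; rewrite -[x]scale1r; exact: KL. Qed.

Lemma closed_subspaceZ X (K : set X) k x :
  closed_subspace K -> K x -> K (k *: x).
Proof. by move=> [_ K0 KL] Kx; rewrite -[_ *: _]addr0; exact: KL. Qed.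

Lemma closed_subspaceT X : closed_subspace [set: X].
Proof. by split=> //; exact: closedT. Qed.

Lemma closed_subspace_preimage X Y (f : X -> Y) (K : set Y) :
  bounded_op f -> closed_subspace K -> closed_subspace (f @^-1` K).
Proof.
move=> [fl fc] [cK K0 KL]; split.
- by apply: preimage_closed => // x _; exact: fc.
- by rewrite /preimage/= linear_fun0.
- by move=> k x y Kx Ky; rewrite /preimage/= fl; exact: KL.
Qed.

Lemma closed_span_subspace X (S : set X) : closed_subspace (closed_span S).
Proof.
split.
- by apply: closed_bigI => K [[cK _ _] _].
- by move=> K [[_ K0 _] _].
- by move=> k x y Sx Sy K KS; have [[_ _ KL] _] := KS; exact: (KL k x y (Sx K KS) (Sy K KS)).
Qed.

Lemma sub_closed_span X (S : set X) : S `<=` closed_span S.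
Proof. by move=> x Sx K [_]; exact. Qed.

Lemma closed_span_min X (S K : set X) :
  closed_subspace K -> S `<=` K -> closed_span S `<=` K.
Proof. by move=> cK SK x; apply. Qed.

Lemma closed_span_mono X (S K : set X) : S `<=` K -> closed_span S `<=` closed_span K.
Proof.
move=> SK; apply: closed_span_min (@closed_span_subspace _ _) _.
by apply: subset_trans SK _; exact: sub_closed_span.
Qed.

Lemma total_ind X I (e : I -> X) (P : set X) :
  total e -> closed_subspace P -> (forall i, P (e i)) -> forall x, P x.
Proof. by move=> te cP Pe; apply: closed_span_ind te cP _ => _ [i _ <-]. Qed.

Lemma total_bounded_op_eq X Y I (e : I -> X) (f g : X -> Y) :
  total e -> bounded_op f -> bounded_op g -> (forall i, f (e i) = g (e i)) ->
  f =1 g.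
Proof. by move=> te fb gb; apply: total_ind te (bounded_op_eq_closed fb gb). Qed.

Lemma ext_eq X Y I (e : I -> X) (f : I -> Y) (g : X -> Y) :
  total e -> bounded_op g -> (forall i, g (e i) = f i) -> ext e f =1 g.
Proof.
move=> te gb ge; rewrite /ext; case: xgetP => [h _ [hb he]|/(_ g)[]//].
by apply: total_bounded_op_eq te hb gb _ => i; rewrite he ge.
Qed.

(** If first coordinates approach [x], the contraction property makes the second ones Cauchy;
    completeness of [Y] provides a limit and closedness of [G] puts the limiting pair in [G]. It
    serves both for images of isometries (graph transposed) and for extending isometries from a
    total family. *)
Lemma closed_graph_domain X (Y : completeNormedModType R[i]) (G : set (X * Y)) :
  closed G ->
  (forall p q, G p -> G q -> `|p.2 - q.2| <= `|p.1 - q.1|) ->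
  closed [set x | exists y, G (x, y)].
Proof.
move=> cG GL x clx.
have /choice[p pP] n : exists p : X * Y, G p /\ `|x - p.1| < (2^-1) ^+ n.
  have /clx[z [[y Gzy]]] : nbhs x (ball x ((2^-1 : R[i]) ^+ n)).
    by apply: nbhsx_ballx; rewrite exprn_gt0 ?invr_gt0.
  by rewrite -ball_normE /= => xz; exists (z, y).
(* The constant 2 counts the distances from [x] to two successive first coordinates, each at most
   [2^-n]. *)
have [n|l pl _] := @geometric_cvg R Y (fun n => (p n).2) 2 (ler0n _ _).
  rewrite (le_trans (GL _ _ (pP _).1 (pP _).1))//.
  rewrite (le_trans (ler_distD x _ _))// mulr_natl mulr2n lerD//.
    rewrite distrC (le_trans (ltW (pP _).2))// exprS ler_piMl ?exprn_ge0 ?invr_ge0//.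
    by rewrite invf_le1// ler1n.
  exact: ltW (pP _).2.
exists l.
have px : (p n).1 @[n --> \oo] --> x.
  apply/cvgrPdist_lt => e /ex_expr2V_lt[N Ne]; exists N => // n /= Nn.
  apply: lt_trans (pP n).2 _; apply: le_lt_trans Ne.
  by rewrite ler_wiXn2l ?invr_ge0// invf_le1// ler1n.
apply: (closed_cvg (F := \oo) (u_ := p) G cG).
  by apply: nearW => n; exact: (pP n).1.
rewrite (_ : p = fun n => ((p n).1, (p n).2)); first exact: cvg_pair px pl.
by apply/funext => n; case: (p n).
Qed.

End Subspaces.

(** * Isometries and projections of Hilbert spaces *)

Section HilbertGeometry.
Variable R : realType.
Implicit Types H K : hilbertType R.

Lemma dot0l H (x : H) : dot 0 x = 0.
Proof. by rewrite dotC dot0r conjC0. Qed.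

Lemma dotDl H (x y z : H) : dot (x + y) z = dot x z + dot y z.
Proof. by rewrite dotC dotDr rmorphD/= -!dotC. Qed.

Lemma dot_eq0 H (x : H) : dot x x = 0 -> x = 0.
Proof. by move/eqP; rewrite dot_norm sqrf_eq0 normr_eq0 => /eqP. Qed.

Lemma eq_dotr H (x y : H) : (forall z, dot z x = dot z y) -> x = y.
Proof.
by move=> xy; apply/eqP; rewrite -subr_eq0; apply/eqP/dot_eq0; rewrite dotBr xy subrr.
Qed.

Lemma norm_le_sqr (V W : normedZmodType R[i]) (x : V) (y : W) :
  `|x| ^+ 2 <= `|y| ^+ 2 -> `|x| <= `|y|.
Proof. by rewrite ler_pXn2r ?nnegrE. Qed.

Lemma dot_bounded_op H (x : H) : bounded_op (dot x : H -> R[i]^o).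
Proof. by split; [exact: dot_linear|exact: dot_continuous]. Qed.

Lemma dot_eq0C H (x y : H) : dot x y = 0 -> dot y x = 0.
Proof. by move=> xy; rewrite dotC xy conjC0. Qed.

Definition isometry H K (f : H -> K) := forall x y, dot (f x) (f y) = dot x y.

Section Isometry.
Variables (H K : hilbertType R) (f : H -> K).
Hypothesis fi : isometry f.

(** The squared norm of the defect of linearity involves only inner products of values of [f], so it
    equals the same expression without [f], which vanishes. *)
Lemma isometry_linear : linear f.
Proof.
move=> k x y; apply/eqP; rewrite -subr_eq0; apply/eqP/dot_eq0.
rewrite !(dotBr, dotDr, dotZr, dotBl, dotDl, dotZl) !fi.
by rewrite !(dotBr, dotDr, dotZr, dotBl, dotDl, dotZl); ring.
Qed.

Lemma isometryD : {morph f : x y / x + y}.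
Proof. by move=> x y; rewrite -[x]scale1r isometry_linear !scale1r. Qed.

Lemma isometry_norm x : `|f x| = `|x|.
Proof.
by apply/eqP; rewrite -(@eqrXn2 _ 2)// -!dot_norm fi.
Qed.

Lemma isometry_bounded_op : bounded_op f.
Proof.
apply: (@linear_bounded_op _ _ _ _ 1) => // x; first exact: isometry_linear.
by rewrite isometry_norm mul1r.
Qed.

(** The image is the domain of the transposed graph of [f] over [L], on which second coordinates are
    determined contractively because [f] preserves norms. *)
Lemma isometry_image_subspace L : closed_subspace L -> closed_subspace (f @` L).
Proof.
move=> cL; have [cl L0 LL] := cL; split.
- have -> : f @` L = [set y | exists x, [set p : K * H | (f p.2 = p.1) /\ L p.2] (y, x)].
    by apply/seteqP; split=> [_ [x Lx <-]|y [x [/= <- Lx]]]; exists x.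
  apply: closed_graph_domain => [|[u x] [v y] [/= ux _] [/= vy _]]; last first.
    by rewrite /= -ux -vy -linear_funB ?isometry_norm//; exact: isometry_linear.
  have snd_bounded : bounded_op (snd : K * H -> H).
    by split=> // x; exact: cvg_snd.
  have fst_bounded : bounded_op (fst : K * H -> K).
    by split=> // x; exact: cvg_fst.
  apply: closedI; last by have [] := closed_subspace_preimage snd_bounded cL.
  have [] // := @bounded_op_eq_closed R (K * H)%type K (fun p => f p.2) fst _ fst_bounded.
  exact: (bounded_op_comp snd_bounded isometry_bounded_op).
- by exists 0 => //; apply: linear_fun0; exact: isometry_linear.
- move=> k _ _ [x Lx <-] [y Ly <-]; exists (k *: x + y); first exact: LL.
  exact: isometry_linear.
Qed.

Lemma isometry_range_subspace : closed_subspace (range f).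
Proof. exact/isometry_image_subspace/closed_subspaceT. Qed.

Lemma isometry_closed_span S : f @` closed_span S = closed_span (f @` S).
Proof.
apply/seteqP; split.
  suff h : closed_span S `<=` f @^-1` closed_span (f @` S).
    by move=> _ [x Sx <-]; exact: h.
  apply: closed_span_min.
    apply: closed_subspace_preimage isometry_bounded_op _.
    exact: closed_span_subspace.
  by move=> y Sy; apply: sub_closed_span; exists y.
apply: closed_span_min.
  exact/isometry_image_subspace/closed_span_subspace.
by move=> _ [x Sx <-]; exists x => //; exact: sub_closed_span.
Qed.

Lemma total_isometry_range I (e : I -> K) :
  total e -> (forall i, exists x, f x = e i) -> forall y, exists x, f x = y.
Proof.
move=> te fe y.
have : range f y.
  apply: total_ind te isometry_range_subspace _ _ => i.
  by have [x fx] := fe i; exists x.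
by case=> x _; exists x.
Qed.

End Isometry.

Lemma isometry_comp H K (L : hilbertType R) (f : H -> K) (g : K -> L) :
  isometry f -> isometry g -> isometry (g \o f).
Proof. by move=> fi gi x y /=; rewrite gi fi. Qed.

Section IsometricExtension.
Variables (H K : hilbertType R) (I : Type) (e : I -> H) (f : I -> K).
Hypothesis te : total e.
Hypothesis ef : forall i j, dot (f i) (f j) = dot (e i) (e j).

(** The graph of the extension is the closed span of the pairs [(e i, f i)]. Equality of inner
    products passes to this span, so it is the graph of an isometry; its domain is a closed subspace
    containing the total family. *)
Lemma isometric_extension : exists2 g, isometry g & forall i, g (e i) = f i.
Proof.
pose G := closed_span (range (fun i => (e i, f i) : H * K)).
have cG : closed_subspace G by exact: closed_span_subspace.
have fst_bounded : bounded_op (fst : H * K -> H) by split=> // x; exact: cvg_fst.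
have snd_bounded : bounded_op (snd : H * K -> K) by split=> // x; exact: cvg_snd.
have graph_closed (x : H) (y : K) :
    closed_subspace [set p : H * K | dot x p.1 = dot y p.2].
  apply: (@bounded_op_eq_closed R (H * K)%type R[i]^o).
    exact: (bounded_op_comp fst_bounded (dot_bounded_op x)).
  exact: (bounded_op_comp snd_bounded (dot_bounded_op y)).
(* Only the second slot of [dot] is linear, so equality is propagated one argument at a time, with a
   conjugation between the two passes. *)
have GE i p : G p -> dot (e i) p.1 = dot (f i) p.2.
  apply: (closed_span_min (graph_closed (e i) (f i))).
  by move=> _ [j _ <-] /=; rewrite ef.
have GG p q : G p -> G q -> dot p.1 q.1 = dot p.2 q.2.
  move=> Gp; apply: (closed_span_min (graph_closed p.1 p.2)).
  by move=> _ [i _ <-] /=; rewrite dotC [RHS]dotC GE.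
have GL p q : G p -> G q -> `|p.2 - q.2| = `|p.1 - q.1|.
  move=> Gp Gq; have Gpq : G (p - q) by exact: (closed_subspaceB cG Gp Gq).
  by apply/eqP; rewrite -(@eqrXn2 _ 2)// -!dot_norm -(GG _ _ Gpq Gpq).
have dom x : exists y, G (x, y).
  have : [set x | exists y, G (x, y)] x; last by [].
  apply: total_ind te _ _ _ => [|i]; last first.
    by exists (f i); apply: sub_closed_span; exists i.
  have [clG G0 GD] := cG; split.
  - apply: closed_graph_domain => // p q Gp Gq; by rewrite GL.
  - by exists 0.
  - move=> k y z [y' Gy] [z' Gz]; exists (k *: y' + z').
    exact: (GD k (y, y') (z, z')).
have [g gP] := choice dom.
exists g => [x y|i].
  exact/esym/(GG (x, g x) (y, g y)).
apply/eqP; rewrite -subr_eq0 -normr_eq0.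
have Gi : G (e i, f i) by apply: sub_closed_span; exists i.
by rewrite (GL (e i, g (e i)) (e i, f i))//= subrr normr0.
Qed.

(** The isometric extension is a witness for [ext], which excludes its default value 0; uniqueness
    on a total family then identifies the two. *)
Lemma ext_isometry : isometry (ext e f).
Proof.
have [g gi ge] := isometric_extension.
have E := ext_eq te (isometry_bounded_op gi) ge.
by move=> x y; rewrite !E gi.
Qed.

Lemma extE i : ext e f (e i) = f i.
Proof.
have [g gi ge] := isometric_extension.
by rewrite (ext_eq te (isometry_bounded_op gi) ge).
Qed.

End IsometricExtension.

(** * Existence of orthogonal projections by minimizing sequences *)

Section Projection.
Variables (H : hilbertType R) (K : set H).
Hypothesis cK : closed_subspace K.

Lemma parallelogram (x y : H) :
  `|x - y| ^+ 2 + `|x + y| ^+ 2 = 2 * (`|x| ^+ 2 + `|y| ^+ 2).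
Proof.
by rewrite -!dot_norm !(dotBl, dotBr, dotDl, dotDr); ring.
Qed.

Lemma norm_sub_component (k u : H) : k != 0 ->
  `|u - (dot k u / `|k| ^+ 2) *: k| ^+ 2 = `|u| ^+ 2 - `|dot k u| ^+ 2 / `|k| ^+ 2.
Proof.
move=> k0.
have N0 : `|k| ^+ 2 != 0 by rewrite sqrf_eq0 normr_eq0.
have NC : (`|k| ^+ 2)^* = `|k| ^+ 2 :> R[i].
  by apply/CrealP; rewrite realE exprn_ge0.
have cE : (dot k u / `|k| ^+ 2)^* = dot u k / `|k| ^+ 2.
  by rewrite rmorphM/= fmorphV/= NC -dotC.
rewrite -dot_norm dotBr dotZr !dotBl !dotZl (dot_norm u) (dot_norm k) cE divfK//.
by rewrite subrr mulr0 subr0 mulrAC (dotC k u) mulrC [X in _ - _ * X]mulrC -normCK mulrC.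
Qed.

(** Norms take values in the partially ordered [R[i]], so the infimum of the squared distances is
    taken over their real parts. *)
Lemma near_projection (x : H) (e : R[i]) : 0 < e ->
  exists2 y, K y & forall z, K z -> `|x - y| ^+ 2 <= `|x - z| ^+ 2 + e.
Proof.
have [_ K0 _] := cK.
have ReE (z : R[i]) : 0 <= z -> z = (complex.Re z)%:C.
  by case: z => a b; rewrite lecE /= => /andP[/eqP -> _].
have sqrE (y : H) : `|y| ^+ 2 = (complex.Re (`|y| ^+ 2))%:C.
  by apply: ReE; rewrite exprn_ge0.
move=> e0; have e0' : 0 < complex.Re e by rewrite -ltcR -ReE// ltW.
pose S := [set complex.Re (`|x - y| ^+ 2) | y in K].
have S_inf : has_inf S.
  split; first by exists (complex.Re (`|x - 0| ^+ 2)); exists 0.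
  by exists 0 => _ [y _ <-]; rewrite -lecR -sqrE exprn_ge0.
have [_ [y Ky <-]] := inf_adherent e0' S_inf.
move=> ylt; exists y => // z Kz.
rewrite sqrE [X in _ <= X + _]sqrE (ReE e (ltW e0)) -rmorphD lecR.
apply: ltW; apply: (lt_le_trans ylt); rewrite lerD2r.
by apply: ge_inf; [exact: S_inf.2|exists z].
Qed.

Lemma projection_exists (x : H) : exists2 y, K y & orth K (x - y).
Proof.
have [clK K0 KD] := cK.
have q0 n : 0 < ((2^-1) ^+ n) ^+ 2 :> R[i] by rewrite !exprn_gt0 ?invr_gt0.
have /choice[y yP] n : exists y, K y /\
    forall z, K z -> `|x - y| ^+ 2 <= `|x - z| ^+ 2 + ((2^-1) ^+ n) ^+ 2.
  by have [y Ky yP] := near_projection x (q0 n); exists y.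
have [n|l yl lP] := @geometric_cvg R H y 2 (ler0n _ _).
  rewrite -(@ler_pXn2r _ 2) ?nnegrE ?mulr_ge0 ?exprn_ge0 ?invr_ge0// exprMn.
  (* The midpoint lies in [K]. Near-minimality bounds both squared distances by that of [m] plus
     [4^-n], and the parallelogram law leaves [4 * 4^-n] for the squared increment; hence the
     squared error in the choice of [y]. *)
  pose m := 2^-1 *: (y n + y n.+1).
  have Km : K m.
    apply: closed_subspaceZ cK _; apply: closed_subspaceD cK _ _; exact: (yP _).1.
  have := parallelogram (x - y n) (x - y n.+1).
  have -> : x - y n - (x - y n.+1) = y n.+1 - y n.
    by rewrite opprB addrC addrA subrK.
  have -> : x - y n + (x - y n.+1) = 2 *: (x - m).
    have -> : 2 *: (x - m) = 2 *: x - 1 *: (y n + y n.+1).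
      by rewrite scalerBr /m scalerA mulfV ?pnatr_eq0.
    by rewrite scale1r scaler_nat mulr2n opprD addrACA.
  rewrite normrZ exprMn normr_nat => par.
  have h1 := (yP n).2 m Km.
  have h2 := (yP n.+1).2 m Km.
  rewrite -(lerD2r (2 ^+ 2 * `|x - m| ^+ 2)) par.
  have -> : 2 ^+ 2 * ((2^-1) ^+ n) ^+ 2 + 2 ^+ 2 * `|x - m| ^+ 2 =
      2 * (`|x - m| ^+ 2 + ((2^-1) ^+ n) ^+ 2 + (`|x - m| ^+ 2 + ((2^-1) ^+ n) ^+ 2)) :> R[i].
    by ring.
  rewrite ler_wpM2l// lerD// (le_trans h2)// lerD2l.
  rewrite ler_pXn2r ?nnegrE ?exprn_ge0 ?invr_ge0// exprS.
  by rewrite ler_piMl ?exprn_ge0 ?invr_ge0// invf_le1// ler1n.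
exists l.
  apply: (closed_cvg K clK _ _ yl).
  by apply: nearW => n; exact: (yP n).1.
move=> k Kk.
(* Moving [y n] by the component of [x - y n] along [k] gives a competitor in [K], so that component
   can lower the squared distance by at most [4^-n]. *)
have kn n : `|dot k (x - y n)| <= `|k| * (2^-1) ^+ n.
  have [->|k0] := eqVneq k 0; first by rewrite dot0l !normr0 mul0r.
  have Np : 0 < `|k| ^+ 2 :> R[i] by rewrite exprn_gt0// normr_gt0.
  have Kz : K (y n + (dot k (x - y n) / `|k| ^+ 2) *: k).
    by apply: closed_subspaceD cK (yP n).1 _; exact: closed_subspaceZ.
  have := (yP n).2 _ Kz; rewrite opprD addrA norm_sub_component//.
  rewrite -addrA lerDl addrC subr_ge0 ler_pdivrMr// mulrC -exprMn.
  by rewrite ler_pXn2r ?nnegrE ?mulr_ge0 ?exprn_ge0 ?invr_ge0.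
(* Here 5 = 1 + 4: one from [kn], and 4 from the distance between [l] and [y n]. *)
apply: (@norm_le_geometric R R[i]^o _ (5 * `|k|)) => [|n]; first by rewrite mulr_ge0.
rewrite (_ : x - l = x - y n - (l - y n)); last by rewrite opprB addrA subrK.
rewrite dotBr (le_trans (ler_normB _ _))//.
rewrite (le_trans (lerD (kn n) (cauchy_schwarz _ _)))//.
rewrite (le_trans (lerD (lexx _) (ler_wpM2l (normr_ge0 k) (lP n))))//.
by rewrite le_eqVlt; apply/orP; left; apply/eqP; ring.
Qed.

End Projection.

End HilbertGeometry.

(** * Orthogonal complements, adjoints of isometries and orthogonal sums *)

Section ProjectionAdjoint.
Variable R : realType.
Implicit Types H K : hilbertType R.

Lemma orth_disjoint H (K : set H) x : K x -> orth K x -> x = 0.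
Proof. by move=> Kx oKx; apply/dot_eq0/oKx. Qed.

Lemma proj_eq H (K : set H) x y :
  closed_subspace K -> K y -> orth K (x - y) -> proj K x = y.
Proof.
move=> cK Ky oy; rewrite /proj; case: xgetP => [z _ [Kz oz]|/(_ y)[]//].
apply/eqP; rewrite -subr_eq0; apply/eqP/(@orth_disjoint _ K).
  exact: closed_subspaceB.
have -> : z - y = (x - y) - (x - z) by rewrite opprB [RHS]addrC subrKA.
exact: closed_subspaceB (orth_closed K) oy oz.
Qed.

Lemma projP H (K : set H) x : closed_subspace K -> K (proj K x) /\ orth K (x - proj K x).
Proof.
move=> cK; have [y Ky oy] := projection_exists cK x.
by rewrite (proj_eq cK Ky oy).
Qed.

Lemma orth_orth H (K : set H) : closed_subspace K -> orth (orth K) `<=` K.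
Proof.
move=> cK x ox; have [Kp op] := projP x cK.
suff -> : x = proj K x by [].
apply/eqP; rewrite -subr_eq0; apply/eqP/dot_eq0.
by rewrite dotBr (ox _ op) dot_eq0C ?subr0// op.
Qed.

Lemma orthS H (K L : set H) : K `<=` L -> orth L `<=` orth K.
Proof. by move=> KL x Lx y /KL/Lx. Qed.

(** The vector running through the span sits in the conjugate-linear slot; symmetry of orthogonality
    moves it to the other slot, where [orth [set x]] is a closed subspace. *)
Lemma orth_closed_span H (S : set H) : orth S `<=` orth (closed_span S).
Proof.
move=> x oS y; have cx := orth_closed [set x].
move=> Sy; apply: dot_eq0C; move: y Sy.
suff h : closed_span S `<=` orth [set x] by move=> y /h; exact.
by apply: closed_span_min => // y /oS yx _ ->; exact: dot_eq0C.
Qed.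

Lemma total_orth H I (e : I -> H) :
  (forall x, (forall i, dot (e i) x = 0) -> x = 0) -> total e.
Proof.
move=> eo; apply/seteqP; split=> // x _.
apply: orth_orth; first exact: closed_span_subspace.
move=> y oy; rewrite (eo y) ?dot0l// => i.
by apply: oy; apply: sub_closed_span; exists i.
Qed.

Lemma total_orth_eq0 H I (e : I -> H) x :
  total e -> (forall i, dot (e i) x = 0) -> x = 0.
Proof.
move=> te ex; apply: dot_eq0; apply: dot_eq0C.
have : orth [set x] x; last by apply.
apply: (total_ind te (orth_closed [set x])) => i _ ->.
exact: dot_eq0C.
Qed.

Section Adjoint.
Variables (H K : hilbertType R) (f : H -> K).
Hypothesis fi : isometry f.

Lemma adj_eq_on y x : (forall z, dot (f z) y = dot z x) -> adj f y = x.
Proof.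
move=> xP; rewrite /adj; case: xgetP => [x' _ x'P|/(_ x)[]//].
by apply: eq_dotr => z; rewrite -x'P xP.
Qed.

(** Since the range of an isometry is closed, [y] can be projected onto it; the preimage of the
    projection is the required value of the adjoint. *)
Lemma adjP x y : dot (f x) y = dot x (adj f y).
Proof.
have [[x' _ fx'] op] := projP y (isometry_range_subspace fi).
have xP z : dot (f z) y = dot z x'.
  apply/eqP; rewrite -subr_eq0 -(fi z x') -dotBr fx'; apply/eqP/op.
  by exists z.
by rewrite (adj_eq_on xP) xP.
Qed.

Lemma isometryK : cancel f (adj f).
Proof. by move=> x; apply: adj_eq_on => z; rewrite fi. Qed.

Lemma adj_range y : range f y -> f (adj f y) = y.
Proof. by move=> [x _ <-]; rewrite isometryK. Qed.

Lemma adj_bounded_op : bounded_op (adj f).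
Proof.
apply: (@linear_bounded_op _ _ _ _ 1) => // [k x y|x].
  by apply: adj_eq_on => z; rewrite dot_linear !adjP dot_linear.
rewrite mul1r.
have [->|f0] := eqVneq (adj f x) 0; first by rewrite normr0.
rewrite -(@ler_pM2l _ `|adj f x|) ?normr_gt0// -expr2 -dot_norm -adjP.
rewrite -(isometry_norm fi (adj f x)).
have := cauchy_schwarz (f (adj f x)) x.
by rewrite adjP dot_norm ger0_norm ?exprn_ge0.
Qed.

End Adjoint.

(** Subtracting both projections from [x] leaves a vector of [K] orthogonal to [K1] and [K2], which
    the last hypothesis kills. *)
Lemma orth_dsum_intro H (K K1 K2 : set H) :
  closed_subspace K -> closed_subspace K1 -> closed_subspace K2 ->
  K1 `<=` K -> K2 `<=` K -> (forall x y, K1 x -> K2 y -> dot x y = 0) ->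
  (forall x, K x -> orth K1 x -> orth K2 x -> x = 0) ->
  orth_dsum K K1 K2.
Proof.
move=> cK cK1 cK2 K1K K2K K12 K0; split=> //; apply/seteqP; split; last first.
  by move=> _ [x K1x [y K2y <-]]; apply: closed_subspaceD; [|exact: K1K|exact: K2K].
move=> x Kx; have [p1 o1] := projP x cK1; have [p2 o2] := projP x cK2.
exists (proj K1 x) => //; exists (proj K2 x) => //.
apply/esym/eqP; rewrite -subr_eq0; apply/eqP/K0.
- by apply: closed_subspaceB => //; apply: closed_subspaceD => //; [exact: K1K|exact: K2K].
- move=> y K1y; rewrite opprD addrA dotBr (o1 _ K1y) (K12 _ _ K1y p2).
  by rewrite subrr.
- move=> y K2y; rewrite [_ + proj K2 x]addrC opprD addrA dotBr (o2 _ K2y).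
  by rewrite (dot_eq0C (K12 _ _ p1 K2y)) subrr.
Qed.

Lemma components_add H (K1 K2 : set H) x y :
  closed_subspace K1 -> closed_subspace K2 ->
  (forall x y, K1 x -> K2 y -> dot x y = 0) ->
  K1 x -> K2 y -> components K1 K2 (x + y) = (x, y).
Proof.
move=> cK1 cK2 K12 K1x K2y; congr pair; apply: proj_eq => // z Kz.
  by rewrite addrC addKr K12.
by rewrite addrK dot_eq0C ?K12.
Qed.

End ProjectionAdjoint.

(** * Automatic continuity of representations *)

Section CStarRepresentation.
Variables (R : realType) (A : cstarAlgType R).
Implicit Types a b c : A.

Lemma cmulBl a b c : cmul (a - b) c = cmul a c - cmul b c.
Proof. exact: (linear_funB (cmul_linearl c)). Qed.

Lemma cmulBr a b c : cmul c (a - b) = cmul c a - cmul c b.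
Proof. exact: (linear_funB (cmul_linearr c)). Qed.

Lemma cadjZ (k : R[i]) a : cadj (k *: a) = k^* *: cadj a.
Proof.
have cadj0 : cadj (0 : A) = 0.
  have := cadj_antilinear 1 (0 : A) 0; rewrite conjC1 !scale1r addr0 => h.
  by apply: (addrI (cadj 0)); rewrite -h addr0.
by rewrite -[k *: a]addr0 cadj_antilinear cadj0 addr0.
Qed.

Lemma cadjD a b : cadj (a + b) = cadj a + cadj b.
Proof. by rewrite -[a]scale1r cadj_antilinear conjC1 !scale1r. Qed.

Lemma cadjB a b : cadj (a - b) = cadj a - cadj b.
Proof. by rewrite cadjD -scaleN1r cadjZ rmorphN1 scaleN1r. Qed.

Lemma norm_cadj a : `|cadj a| = `|a|.
Proof.
have le b : `|b| <= `|cadj b|.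
  have [->|b0] := eqVneq b 0; first by rewrite normr0.
  rewrite -(@ler_pM2r _ `|b|) ?normr_gt0// -expr2 -normcC.
  exact: normcM.
by apply/eqP; rewrite eq_le le andbT -{2}(cadjK a) le.
Qed.

(* The iteration b := (c + b^2) / 2 converges to 1 - sqrt(1 - c). *)
Lemma ex_selfadjoint_sqrt c : cadj c = c -> `|c| <= 4^-1 ->
  exists2 b, cadj b = b & b + b - cmul b b = c.
Proof.
move=> cC c4.
pose u := fix u n := if n is n.+1 then 2^-1 *: (c + cmul (u n) (u n)) else 0 : A.
have sqrB a b : cmul a a - cmul b b = cmul a (a - b) + cmul (a - b) b.
  by rewrite cmulBr cmulBl addrA subrK.
have norm_sqrB a b : `|cmul a a - cmul b b| <= (`|a| + `|b|) * `|a - b|.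
  rewrite sqrB (le_trans (ler_normD _ _))// mulrDl lerD ?normcM//.
  by rewrite mulrC normcM.
have norm2V : `|2^-1 : R[i]| = 2^-1 by rewrite ger0_norm ?invr_ge0.
(* On the ball of radius 1/2 squaring is 1-Lipschitz, so the halved iteration contracts by 1/2; the
   bound 1/4 on [c] keeps the iterates in this ball. *)
have u2 n : `|u n| <= 2^-1.
  elim: n => [|n ih] /=; first by rewrite normr0 invr_ge0.
  rewrite normrZ norm2V ler_piMr ?invr_ge0// (le_trans (ler_normD _ _))//.
  rewrite (le_trans (lerD c4 (le_trans (normcM _ _) (ler_pM _ _ ih ih))))//.
  rewrite (_ : 4^-1 + 2^-1 * 2^-1 = 2^-1); last by field.
  by rewrite invf_le1// ler1n.
have uC n : cadj (u n) = u n.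
  elim: n => [|n ih] /=; first by rewrite -(scale0r (0 : A)) cadjZ conjC0 !scale0r.
  rewrite cadjZ cadjD cC cadjM ih; congr (_ *: _).
  by rewrite fmorphV/= conjC_nat.
have [n|b ub bP] := @geometric_cvg R A u 1 ler01.
  rewrite mul1r; elim: n => [|n ih].
    rewrite /= subr0 normrZ norm2V expr0 mulr_ile1 ?invr_ge0 ?invf_le1 ?ler1n//.
    rewrite (linear_fun0 (cmul_linearl _)) addr0.
    by rewrite (le_trans c4)// invf_le1// ler1n.
  rewrite /= -scalerBr opprD addrACA subrr add0r normrZ norm2V.
  rewrite exprS ler_wpM2l ?invr_ge0// (le_trans (norm_sqrB _ _))//.
  rewrite -[leRHS]mul1r ler_pM ?addr_ge0//.
  rewrite (le_trans (lerD (u2 n.+1) (u2 n)))//.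
  by rewrite (_ : 2^-1 + 2^-1 = 1)//; field.
have b2 : `|b| <= 2 by have := bP 0%N; rewrite subr0 mul1r expr0 mulr1.
exists b.
  apply/eqP; rewrite -subr_eq0; apply/eqP.
  (* [b - u n] is at most [2 * 2^-n] and is counted twice, once through its adjoint. *)
  apply: (@norm_le_geometric R A _ 4) => // n.
  rewrite (_ : _ - b = cadj (b - u n) - (b - u n)); last first.
    by rewrite cadjB uC opprB subrKA.
  rewrite (le_trans (ler_normB _ _))// norm_cadj (le_trans (lerD (bP n) (bP n)))//.
  by rewrite le_eqVlt; apply/orP; left; apply/eqP; ring.
apply/eqP; rewrite -subr_eq0; apply/eqP.
(* Here 7 = 2 + 5: twice the error at [n.+1] gives 2, and the difference of squares gives
   [(2 + 1/2) * 2 = 5]. *)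
apply: (@norm_le_geometric R A _ 7) => // n.
have -> : b + b - cmul b b - c = 2 *: (b - u n.+1) - (cmul b b - cmul (u n) (u n)).
  rewrite /= scalerBr scalerA mulfV ?pnatr_eq0// scale1r scaler_nat mulr2n.
  by rewrite opprB addrA opprD addrA subrK [RHS]addrAC.
rewrite (le_trans (ler_normB _ _))// normrZ normr_nat.
rewrite (le_trans (lerD (ler_wpM2l _ (bP n.+1)) (norm_sqrB _ _)))//.
rewrite (le_trans (lerD (lexx _) (ler_pM _ _ (lerD b2 (u2 n)) (bP n))))// ?addr_ge0//.
by rewrite le_eqVlt exprS; apply/orP; left; apply/eqP; field.
Qed.

Variable H : repType A.

Lemma act_linearBl (h : H) : {morph act^~ h : a b / a - b}.
Proof. exact: (linear_funB (act_linear h)). Qed.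

Lemma act0l (h : H) : act (0 : A) h = 0.
Proof. exact: (linear_fun0 (act_linear h)). Qed.

(* Writing a^* a = 2 b - b^2 with b self-adjoint, one has
   |h|^2 - |a h|^2 = |h - b h|^2. *)
Lemma norm_act_small a (h : H) : `|a| <= 2^-1 -> `|act a h| <= `|h|.
Proof.
move=> a2.
have cC : cadj (cmul (cadj a) a) = cmul (cadj a) a by rewrite cadjM cadjK.
have [|b bC bE] := ex_selfadjoint_sqrt cC.
  rewrite normcC (_ : 4^-1 = 2^-1 ^+ 2) ?ler_pXn2r ?nnegrE ?invr_ge0//.
  by field.
apply: norm_le_sqr; rewrite -!dot_norm act_adj -actM -bE act_linearBl.
have -> : act (b + b) h = act b h + act b h.
  by rewrite -[X in X + b]scale1r act_linear scale1r.
rewrite actM -subr_ge0.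
have -> : dot h h - dot h (act b h + act b h - act b (act b h)) =
    dot (h - act b h) (h - act b h).
  rewrite !(dotBl, dotBr, dotDr) !act_adj bC; ring.
by rewrite dot_norm exprn_ge0.
Qed.

(** Rescaling [a] to norm 1/2 reduces to [norm_act_small] and produces the factor 2. The sharp
    constant is 1, but any bound linear in the norm of [a] yields the continuity of elementary
    tensors. *)
Lemma norm_act a (h : H) : `|act a h| <= 2 * `|a| * `|h|.
Proof.
have [->|a0] := eqVneq a 0.
  by rewrite act0l !normr0 mulr0 mul0r.
have a2 : 0 < 2 * `|a| by rewrite mulr_gt0 ?normr_gt0.
have aE : act a h = (2 * `|a|) *: act ((2 * `|a|)^-1 *: a) h.
  rewrite -[_ *: a]addr0 act_linear act0l addr0.
  by rewrite scalerA mulfV ?scale1r// gt_eqF.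
rewrite aE normrZ (ger0_norm (ltW a2)) ler_wpM2l ?(ltW a2)// norm_act_small//.
by rewrite normrZ ger0_norm ?invr_ge0 ?(ltW a2)// invfM mulfVK ?normr_eq0.
Qed.

End CStarRepresentation.

(** * Interior tensor products *)

Section Tensors.
Variables (R : realType) (A : cstarAlgType R).
Implicit Types (F G : corrType A) (H K : repType A).

Definition equivariant H K (f : H -> K) := forall a x, f (act a x) = act a (f x).

(** [V] has the inner products of elementary tensors, so [tilde V] is isometric. Letting the values
    lie in another space [K] covers [tensop] as well as covariant representations. *)
Definition tensor_isometric F H K (V : F -> H -> K) :=
  forall x y h k, dot (V x h) (V y k) = dot h (act (hdot x y) k).

Lemma total_dot_eq (H : hilbertType R) I (e : I -> H) x y :
  total e -> (forall i, dot (e i) x = dot (e i) y) -> x = y.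
Proof.
move=> te xy; apply/eqP; rewrite -subr_eq0; apply/eqP/(total_orth_eq0 te) => i.
by rewrite dotBr xy subrr.
Qed.

Lemma total_reindex (X : normedModType R[i]) I J (e : I -> X) (f : J -> X) :
  total e -> (forall i, exists j, f j = e i) -> total f.
Proof.
move=> te fe; apply/seteqP; split=> // x _.
apply: (total_ind te (closed_span_subspace _)) => i.
by have [j <-] := fe i; apply: sub_closed_span; exists j.
Qed.

Lemma adj_equivariant H K (f : H -> K) :
  isometry f -> equivariant f -> equivariant (adj f).
Proof.
move=> fi fe a y; apply: adj_eq_on => z.
by rewrite -[a]cadjK -act_adj -fe (adjP fi) act_adj.
Qed.

Lemma equivariant_comp H K (L : repType A) (f : H -> K) (g : K -> L) :
  equivariant f -> equivariant g -> equivariant (g \o f).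
Proof. by move=> fe ge a x /=; rewrite fe ge. Qed.

Lemma closed_invariant_orth H (S : set H) :
  (forall a x, S x -> S (act a x)) -> closed_invariant (orth S).
Proof.
move=> SA; split; first exact: orth_closed.
move=> a x oS y Sy; rewrite -[a]cadjK -act_adj; exact/oS/SA.
Qed.

Section HilbertTensor.
Variables (F : corrType A) (K : repType A) (Q : htensor F K).
Local Notation "x (x) h" := (ht_map Q x h) (at level 40).

(** Linearity is forced by the inner products: both sides agree when tested against the total family
    of elementary tensors. *)
Lemma ht_linearl h : linear (fun x => x (x) h).
Proof.
move=> k x y; apply: total_dot_eq (ht_total Q) _ => -[x' h'] /=.
rewrite ht_dot dotDr dotZr !ht_dot hdot_linear act_linear dotDr dotZr.
by [].
Qed.

Lemma ht_linearr x : linear (fun h => x (x) h).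
Proof.
move=> k h h1; apply: total_dot_eq (ht_total Q) _ => -[x' h'] /=.
have [al _] := act_bounded (hdot x' x) :> bounded_op (act _ : K -> K).
by rewrite ht_dot dotDr dotZr !ht_dot al dotDr dotZr.
Qed.

Lemma ht_norm x h : `|x (x) h| <= 2 * `|x| * `|h|.
Proof.
rewrite -(@ler_pXn2r _ 2) ?nnegrE ?mulr_ge0// -dot_norm ht_dot.
have := cauchy_schwarz h (act (hdot x x) h).
rewrite -(ht_dot Q) dot_norm ger0_norm ?exprn_ge0// => /le_trans; apply.
rewrite (le_trans (ler_wpM2l _ (norm_act _ _)))// hdot_norm.
have -> : `|h| * (2 * `|x| ^+ 2 * `|h|) = 2 * (`|x| * `|h|) ^+ 2 by ring.
rewrite -[2 * `|x| * `|h|]mulrA [leRHS]exprMn.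
by rewrite ler_wpM2r ?exprn_ge0 ?mulr_ge0// -natrX ler_nat.
Qed.

Lemma ht_bounded_opl h : bounded_op (fun x => x (x) h).
Proof.
apply: (@linear_bounded_op _ _ _ _ (2 * `|h|)); first exact: ht_linearl.
  by rewrite mulr_ge0.
by move=> x; rewrite mulrAC ht_norm.
Qed.

Lemma ht_bounded_opr x : bounded_op (fun h => x (x) h).
Proof.
apply: (@linear_bounded_op _ _ _ _ (2 * `|x|)); first exact: ht_linearr.
  by rewrite mulr_ge0.
by move=> h; rewrite ht_norm.
Qed.

Lemma ht_total_left I (e : I -> F) :
  total e -> total (fun p : I * K => e p.1 (x) p.2).
Proof.
move=> te; apply/seteqP; split=> // z _.
have cS := closed_span_subspace (range (fun p : I * K => e p.1 (x) p.2)).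
apply: (total_ind (ht_total Q) cS) => -[x h] /=.
apply: (total_ind te (closed_subspace_preimage (ht_bounded_opl h) cS)) => i.
by apply: sub_closed_span; exists (i, h).
Qed.

Lemma ht_total_right I (e : I -> K) :
  total e -> total (fun p : F * I => p.1 (x) e p.2).
Proof.
move=> te; apply/seteqP; split=> // z _.
have cS := closed_span_subspace (range (fun p : F * I => p.1 (x) e p.2)).
apply: (total_ind (ht_total Q) cS) => -[x h] /=.
apply: (total_ind te (closed_subspace_preimage (ht_bounded_opr x) cS)) => i.
by apply: sub_closed_span; exists (x, i).
Qed.

End HilbertTensor.

Variable T : realization A.
Local Notation hm F H := (ht_map (htens T F H)).

Section Tilde.
Variables (F : corrType A) (H K : repType A) (V : F -> H -> K).
Hypothesis Vi : tensor_isometric V.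

Let Vdot (p q : F * H) : dot (V p.1 p.2) (V q.1 q.2) =
  dot (hm F H p.1 p.2) (hm F H q.1 q.2).
Proof. by rewrite ht_dot Vi. Qed.

Lemma tilde_isometry : isometry (tilde V : htens T F H -> K).
Proof. exact: (ext_isometry (ht_total _) Vdot). Qed.

Lemma tildeE x h : tilde V (hm F H x h) = V x h.
Proof. exact: (extE (ht_total _) Vdot (x, h)). Qed.

Lemma tilde_equivariant_isometry :
  (forall a x h, V (lmod a x) h = act a (V x h)) ->
  equivariant (tilde V : htens T F H -> K).
Proof. by move=> VE a; exact: (tilde_equivariant (VE a)). Qed.

End Tilde.

Section Tensop.
Variables (F G : corrType A) (H K : repType A) (t : F -> G) (f : H -> K).
Hypothesis ti : forall x y, hdot (t x) (t y) = hdot x y.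
Hypothesis fi : isometry f.
Hypothesis fe : equivariant f.

Let tf_isometric : tensor_isometric (fun x h => hm G K (t x) (f h)).
Proof. by move=> x y h k; rewrite ht_dot ti -fe fi. Qed.

Lemma tensop_isometry : isometry (tensop t f : htens T F H -> htens T G K).
Proof. exact: tilde_isometry tf_isometric. Qed.

Lemma tensopE x h : tensop t f (hm F H x h) = hm G K (t x) (f h).
Proof. exact: tildeE tf_isometric x h. Qed.

End Tensop.

Lemma tensop_id F H (u : htens T F H) : tensop idfun idfun u = u.
Proof.
move: u; apply: ext_eq; [exact: ht_total| |by []].
exact: (@isometry_bounded_op _ _ _ id).
Qed.

Section TensorAdjoint.
Variables (F : corrType A) (H K : repType A) (f : H -> K).
Hypothesis fi : isometry f.
Hypothesis fe : equivariant f.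

Lemma adj_tensopE x k : adj (tensop idfun f) (hm F K x k) = hm F H x (adj f k).
Proof.
apply: total_dot_eq (ht_total _) _ => -[x' h'] /=.
rewrite -adjP; last exact: tensop_isometry.
by rewrite tensopE// !ht_dot (adjP fi) (adj_equivariant fi fe).
Qed.

(** [adj f] need not be isometric, so [tensop_isometry] does not apply to it. The adjoint of the
    isometry [tensop idfun f] is a bounded operator with the right values on elementary tensors. *)
Lemma tensop_adj :
  tensop idfun (adj f) =1 adj (tensop idfun f) :> (htens T F K -> htens T F H).
Proof.
apply: ext_eq; [exact: ht_total|exact/adj_bounded_op/tensop_isometry|].
by move=> [x k]; rewrite adj_tensopE.
Qed.

End TensorAdjoint.

Section Assoc.
Variables (F G : corrType A) (H : repType A).

Let source_total := ht_total_left (htens T (tens T F G) H) (it_total (tens T F G)).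

Let target_total :
  total (fun p : F * G * H => hm F (htens T G H) p.1.1 (hm G H p.1.2 p.2)).
Proof.
apply: total_reindex (ht_total_right (htens T F (htens T G H)) (ht_total _)) _.
by move=> [x [y h]]; exists (x, y, h).
Qed.

(** Read in the two directions, this one identity yields both [assoc] and [assocV]. *)
Let assoc_dot (p q : F * G * H) :
  dot (hm F (htens T G H) p.1.1 (hm G H p.1.2 p.2))
      (hm F (htens T G H) q.1.1 (hm G H q.1.2 q.2)) =
  dot (hm (tens T F G) H (it_map (tens T F G) p.1.1 p.1.2) p.2)
      (hm (tens T F G) H (it_map (tens T F G) q.1.1 q.1.2) q.2).
Proof. by rewrite !ht_dot ht_act ht_dot it_dot. Qed.

Lemma assoc_isometry : isometry (@assoc _ _ T F G H).
Proof. exact: (ext_isometry source_total assoc_dot). Qed.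

Lemma assocE x y h : assoc (hm (tens T F G) H (it_map (tens T F G) x y) h) =
  hm F (htens T G H) x (hm G H y h).
Proof. exact: (extE source_total assoc_dot (x, y, h)). Qed.

Lemma assocV_isometry : isometry (@assocV _ _ T F G H).
Proof. exact: (ext_isometry target_total (fun p q => esym (assoc_dot p q))). Qed.

Lemma assocVE x y h : assocV (hm F (htens T G H) x (hm G H y h)) =
  hm (tens T F G) H (it_map (tens T F G) x y) h.
Proof. exact: (extE target_total (fun p q => esym (assoc_dot p q)) (x, y, h)). Qed.

Lemma assocK : cancel (@assoc _ _ T F G H) (@assocV _ _ T F G H).
Proof.
apply: (total_bounded_op_eq source_total) => [||[[x y] h]].
- by apply: isometry_bounded_op; exact: isometry_comp assoc_isometry assocV_isometry.
- exact: (@isometry_bounded_op _ _ _ id).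
- by rewrite /= assocE assocVE.
Qed.

Lemma assocVK : cancel (@assocV _ _ T F G H) (@assoc _ _ T F G H).
Proof.
apply: (total_bounded_op_eq target_total) => [||[[x y] h]].
- by apply: isometry_bounded_op; exact: isometry_comp assocV_isometry assoc_isometry.
- exact: (@isometry_bounded_op _ _ _ id).
- by rewrite /= assocVE assocE.
Qed.

Lemma assoc_equivariant : equivariant (@assoc _ _ T F G H).
Proof.
move=> a; apply: (ext_equivariant source_total) => -[[x y] h].
by exists (lmod a x, y, h); rewrite ht_act ?it_lmod.
Qed.

End Assoc.

(** * Subspaces spanned by tensors with second factor in a given set *)

Section Tset.

Lemma tset_subspace F H (S : set H) : closed_subspace (tset T F S).
Proof. exact: closed_span_subspace. Qed.

Lemma tset_ht_map F H (S : set H) x h : S h -> tset T F S (hm F H x h).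
Proof. by move=> Sh; apply: sub_closed_span; exists x => //; exists h. Qed.

Lemma tsetT F H z : tset T F [set: H] z.
Proof.
apply: (total_ind (ht_total (htens T F H)) (tset_subspace F setT)) => -[x h].
exact: tset_ht_map.
Qed.

Lemma tset_min F H (S : set H) (P : set (htens T F H)) :
  closed_subspace P -> (forall x h, S h -> P (hm F H x h)) -> tset T F S `<=` P.
Proof. by move=> cP SP; apply: closed_span_min => // _ [x _ [h Sh <-]]; exact: SP. Qed.

Lemma tset_map F G H K (f : htens T F H -> htens T G K) (S : set H) (S' : set K) :
  bounded_op f -> (forall x h, S h -> tset T G S' (f (hm F H x h))) ->
  forall z, tset T F S z -> tset T G S' (f z).
Proof.
move=> fb fS; apply: tset_min => //.
exact: (closed_subspace_preimage fb (tset_subspace G S')).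
Qed.

Lemma tset_tensop F H K (f : H -> K) (S : set H) : isometry f -> equivariant f ->
  tensop idfun f @` tset T F S = tset T F (f @` S).
Proof.
move=> fi fe; rewrite isometry_closed_span; last exact: tensop_isometry.
congr closed_span; apply/seteqP; split.
  move=> _ [_ [x _ [h Sh <-]] <-]; rewrite tensopE//.
  by exists x => //; exists (f h) => //; exists h.
move=> _ [x _ [_ [h Sh <-] <-]]; exists (hm F H x h); last by rewrite tensopE.
by exists x => //; exists h.
Qed.

Lemma tset_assocV F G H (S : set H) :
  @assocV _ _ T F G H @` tset T F (tset T G S) = tset T (tens T F G) S.
Proof.
have bV := isometry_bounded_op (@assocV_isometry F G H).
have bA := isometry_bounded_op (@assoc_isometry F G H).
apply/seteqP; split=> [_ [z Sz <-]|z Sz].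
  move: z Sz; apply: tset_min.
    exact: (closed_subspace_preimage bV (tset_subspace (tens T F G) S)).
  move=> x; apply: tset_min.
    have cP := closed_subspace_preimage bV (tset_subspace (tens T F G) S).
    exact: (closed_subspace_preimage (ht_bounded_opr (htens T F (htens T G H)) x) cP).
  by move=> y h Sh; rewrite /preimage/= assocVE; exact: tset_ht_map.
exists (assoc z); last exact: assocK.
have cP := closed_subspace_preimage bA (tset_subspace F (tset T G S)).
move: z Sz; apply: tset_min.
  exact: cP.
move=> z h Sh.
have cPh := closed_subspace_preimage (ht_bounded_opl (htens T (tens T F G) H) h) cP.
apply: (total_ind (it_total (tens T F G)) cPh).
by move=> [x y]; rewrite /preimage/= assocE; apply: tset_ht_map; exact: tset_ht_map.
Qed.

(** The inner product of two elementary tensors lets the algebra act on the second Hilbert space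
    vector, which is why [S'] must be invariant. *)
Lemma tset_orth F H (S S' : set H) : (forall a h, S' h -> S' (act a h)) ->
  (forall h k, S h -> S' k -> dot h k = 0) ->
  forall x y, tset T F S x -> tset T F S' y -> dot x y = 0.
Proof.
move=> S'A SS' x y Sx S'y; apply: dot_eq0C.
suff h0 : tset T F S `<=` orth (tset T F S') by apply: h0.
apply: tset_min => [|{Sx}x h Sh {S'y}y S'y]; first exact: orth_closed.
apply: dot_eq0C; move: y S'y.
suff h0 : tset T F S' `<=` orth [set hm F H x h] by move=> y /h0; exact.
apply: tset_min => [|x' h' Sh' _ ->]; first exact: orth_closed.
by rewrite ht_dot SS'//; exact: S'A.
Qed.

(** Every generator [y (x) h] splits along [h = h1 + h2], so a vector orthogonal to both parts is
    orthogonal to the whole span. *)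
Lemma tset_orth_dsum F H (K K1 K2 : set H) : closed_subspace K1 -> closed_subspace K2 ->
  (forall a h, K2 h -> K2 (act a h)) ->
  orth_dsum K K1 K2 -> orth_dsum (tset T F K) (tset T F K1) (tset T F K2).
Proof.
move=> [_ K10 _] [_ K20 _] K2A [K12 KE].
apply: orth_dsum_intro; try exact: tset_subspace.
- apply: closed_span_mono => _ [x _ [h K1h <-]]; exists x => //; exists h => //.
  by rewrite KE; exists h => //; exists 0 => //; rewrite addr0.
- apply: closed_span_mono => _ [x _ [h K2h <-]]; exists x => //; exists h => //.
  by rewrite KE; exists 0 => //; exists h => //; rewrite add0r.
- exact: tset_orth.
- move=> x Kx o1 o2; apply: orth_disjoint Kx _; apply: orth_closed_span.
  move=> _ [y _ [h Kh <-]]; move: Kh; rewrite KE => -[h1 K1h [h2 K2h <-]].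
  have := ht_linearr (htens T F H) y 1 h1 h2; rewrite !scale1r => ->.
  by rewrite dotDl (o1 _ (tset_ht_map _ K1h)) (o2 _ (tset_ht_map _ K2h)) addr0.
Qed.

End Tset.

End Tensors.

(** * The Wold-von Neumann decomposition *)

Section Wold.
Local Arguments tilde_pow : simpl never.
Local Arguments tpow : simpl never.
Variables (R : realType) (A : cstarAlgType R) (T : realization A).
Variables (F : corrType A) (H : repType A) (V : F -> H -> H).
Hypothesis H_nondeg : nondegenerate H.
Hypothesis Vi : tensor_isometric V.
Hypothesis V_lmod : forall a x h, V (lmod a x) h = act a (V x h).
Local Notation hm G K := (ht_map (htens T G K)).
Local Notation Vn := (tilde_pow (T := T) V).

Lemma tensor_isometric_bounded_op x : bounded_op (V x).
Proof.
have -> : V x = tilde V \o (hm F H x).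
  by apply/funext => h /=; rewrite tildeE.
exact: (bounded_op_comp (ht_bounded_opr (htens T F H) x)
  (isometry_bounded_op (tilde_isometry (T := T) Vi))).
Qed.

(** The two properties are proved together: the isometry of power [n.+1] has to move the action of
    an inner product inside the power [n]. *)
Lemma tilde_pow_isometry_equivariant n :
  isometry (Vn (n := n)) /\ equivariant (Vn (n := n)).
Proof.
elim: n => [|n [Vni Vne]].
  have acti : tensor_isometric (fun (a : regular A) (h : H) => act (a : A) h).
    by move=> a b h k; rewrite act_adj -actM.
  split; first exact: tilde_isometry.
  by apply: tilde_equivariant_isometry => a x h; rewrite -actM.
have tS := ht_total_left (htens T (tpow T F n.+1) H) (it_total (tens T F (tpow T F n))).
split.
  apply: (ext_isometry tS) => -[[x y] h] [[x' y'] h'] /=.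
  by rewrite Vi -Vne ht_act Vni !ht_dot it_dot.
move=> a; apply: (ext_equivariant tS) => -[[x y] h].
by exists (lmod a x, y, h); rewrite ?ht_act ?it_lmod//= V_lmod.
Qed.

Lemma tilde_pow_isometry n : isometry (Vn (n := n)).
Proof. by have [] := tilde_pow_isometry_equivariant n. Qed.

Lemma tilde_pow_equivariant n : equivariant (Vn (n := n)).
Proof. by have [] := tilde_pow_isometry_equivariant n. Qed.

Lemma tilde_pow_bounded_op n : bounded_op (Vn (n := n)).
Proof. exact/isometry_bounded_op/tilde_pow_isometry. Qed.

Lemma tilde_pow0E a h : Vn (n := 0) (hm (regular A) H a h) = act (a : A) h.
Proof.
have acti : tensor_isometric (fun (a : regular A) (h : H) => act (a : A) h).
  by move=> b c k l; rewrite act_adj -actM.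
exact: (tildeE T acti).
Qed.

Lemma tilde_powSE n x y h :
  Vn (n := n.+1) (hm (tpow T F n.+1) H (it_map (tens T F (tpow T F n)) x y) h) =
  V x (Vn (hm (tpow T F n) H y h)).
Proof.
have tS := ht_total_left (htens T (tpow T F n.+1) H) (it_total (tens T F (tpow T F n))).
apply: (extE tS _ (x, y, h)) => -[[x1 y1] h1] [[x2 y2] h2] /=.
rewrite Vi -tilde_pow_equivariant ht_act tilde_pow_isometry.
by rewrite !ht_dot it_dot.
Qed.

(** Nondegeneracy makes the vectors [act a k] total, and the range of an isometry is closed. This is
    the identification of [A (x) H] with [H]. *)
Lemma tilde_pow0_range h : range (Vn (n := 0)) h.
Proof.
apply: (total_ind H_nondeg (isometry_range_subspace (@tilde_pow_isometry 0))) => -[a k].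
by exists (hm (regular A) H a k); rewrite ?tilde_pow0E.
Qed.

Lemma tilde_powS_range n x u : range (Vn (n := n.+1)) (V x (Vn (n := n) u)).
Proof.
have cR := isometry_range_subspace (@tilde_pow_isometry n.+1).
have cP := closed_subspace_preimage
  (bounded_op_comp (@tilde_pow_bounded_op n) (tensor_isometric_bounded_op x)) cR.
apply: (total_ind (ht_total _) cP) => -[y h] /=.
exists (hm (tpow T F n.+1) H (it_map (tens T F (tpow T F n)) x y) h) => //=.
by rewrite tilde_powSE.
Qed.

(** Powers are built by adding factors on the left, whereas the Wold argument adds one on the right.
    Induction carries the extra factor inwards until the algebra coefficient is absorbed by
    [V_lmod]. *)
Lemma tilde_pow_comp_range n y x k :
  range (Vn (n := n.+1)) (Vn (hm (tpow T F n) H y (V x k))).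
Proof.
elim: n y => [|n ih] y.
  rewrite tilde_pow0E -V_lmod.
  by have [u _ <-] := tilde_pow0_range k; exact: tilde_powS_range.
have cR := isometry_range_subspace (@tilde_pow_isometry n.+2).
have cP := closed_subspace_preimage (bounded_op_comp
  (ht_bounded_opl (htens T (tpow T F n.+1) H) (V x k)) (@tilde_pow_bounded_op n.+1)) cR.
apply: (total_ind (it_total _) cP) => -[x' y'].
rewrite /preimage/= tilde_powSE.
by have [u _ <-] := ih y'; exact: tilde_powS_range.
Qed.

(** * The Wold unitary for a copy [j : L -> H] of the wandering subspace *)

Variables (L : repType A) (j : L -> H).
Hypothesis ji : isometry j.
Hypothesis je : equivariant j.
Hypothesis jP : range j = orth (range (tilde V : htens T F H -> H)).

Let tilde_cs : closed_subspace (range (tilde V : htens T F H -> H)).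
Proof. exact: isometry_range_subspace (tilde_isometry (T := T) Vi). Qed.

Lemma wandering_orth w x k : dot (j w) (V x k) = 0.
Proof.
apply: dot_eq0C.
have : range j (j w) by exists w.
by rewrite jP; apply; exists (hm F H x k) => //; rewrite tildeE.
Qed.

Lemma wandering_dsum : orth_dsum setT (range j) (range (tilde V : htens T F H -> H)).
Proof.
rewrite jP; apply: orth_dsum_intro => //.
- exact: orth_closed.
- by move=> x y ox Vy; apply/dot_eq0C/ox.
- by move=> x _ o1 o2; exact: orth_disjoint o2 o1.
Qed.

Lemma wandering_dsum_tensor G :
  orth_dsum (tset T G setT) (tset T G (range j))
    (tset T G (range (tilde V : htens T F H -> H))).
Proof.
apply: tset_orth_dsum wandering_dsum => //.
  exact: isometry_range_subspace.
move=> a _ [z _ <-]; exists (act a z) => //.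
exact: tilde_equivariant_isometry.
Qed.

Hypothesis V_pure : pure T V.

(** Let [h] be orthogonal to the family. If [h] is the image of [z] under power [n], then [z] is
    orthogonal to the wandering part, hence lies in the part over the range of [tilde V], and [h] is
    in the range of power [n.+1]. So [h] is fixed by all the range projections, and purity gives
    [h = 0]. *)
Lemma wold_total : total (fun p : {n & tpow T F n} * L =>
  Vn (hm (tpow T F (projT1 p.1)) H (projT2 p.1) (j p.2))).
Proof.
apply: total_orth => h ho.
have hR n : range (Vn (n := n)) h.
  elim: n => [|n [z _ zh]]; first exact: tilde_pow0_range.
  have [d12 dE] := wandering_dsum_tensor (tpow T F n).
  have zo : orth (tset T (tpow T F n) (range j)) z.
    apply: orth_closed_span => _ [y _ [_ [w _ <-] <-]].
    rewrite -(@tilde_pow_isometry n) zh; exact: (ho (existT _ n y, w)).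
  have := tsetT z.
  rewrite dE => -[z1 z1j [z2 z2V zE]].
  have z10 : z1 = 0.
    apply: dot_eq0; have := zo _ z1j; rewrite -zE dotDr.
    by rewrite (d12 _ _ z1j z2V) addr0.
  rewrite -zh -zE z10 add0r; move: z2 z2V {zE}.
  have cR := closed_subspace_preimage (@tilde_pow_bounded_op n)
    (isometry_range_subspace (@tilde_pow_isometry n.+1)).
  apply: tset_min => // y _ [u _ <-].
  have cP := closed_subspace_preimage (bounded_op_comp
     (isometry_bounded_op (tilde_isometry (T := T) Vi))
     (ht_bounded_opr (htens T (tpow T F n) H) y)) cR.
  apply: (total_ind (ht_total _) cP) => -[x k].
  by rewrite /preimage/= tildeE//; exact: tilde_pow_comp_range.
have := V_pure h.
rewrite (_ : (fun n => _) = fun=> h); last first.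
  by apply/funext => n; rewrite (adj_range (@tilde_pow_isometry n) (hR n)).
move=> h0; exact: (cvg_unique (@norm_hausdorff _ _) (cvg_cst h) h0).
Qed.

(** Common outer factors are stripped by isometry, the resulting coefficient being pushed into the
    longer power, until the shorter power is 0; then [wandering_orth] applies. *)
Lemma tilde_pow_orth n m y w u : (n < m)%N ->
  dot (Vn (n := n) (hm (tpow T F n) H y (j w))) (Vn (n := m) u) = 0.
Proof.
elim: n m y u => [|n ih] [|m]// y u nm.
  rewrite tilde_pow0E -je; set w' := act _ w.
  have cP := closed_subspace_preimage (@tilde_pow_bounded_op m.+1) (orth_closed [set j w']).
  suff h v : orth [set j w'] (Vn (n := m.+1) v) by exact: h.
  move: v; apply: (total_ind (ht_total_left _ (it_total _)) cP) => -[[x y'] h] _ ->.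
  by rewrite tilde_powSE wandering_orth.
have cP v := closed_subspace_preimage (bounded_op_comp
  (ht_bounded_opl (htens T (tpow T F n.+1) H) (j w)) (@tilde_pow_bounded_op n.+1))
  (orth_closed [set v]).
suff h z : orth [set Vn (n := m.+1) u] (Vn (hm (tpow T F n.+1) H z (j w))).
  by apply/dot_eq0C/h.
move: z; apply: (total_ind (it_total _) (cP _)) => -[x y1] _ ->.
have cQ := closed_subspace_preimage (@tilde_pow_bounded_op m.+1)
  (orth_closed [set V x (Vn (hm (tpow T F n) H y1 (j w)))]).
apply: dot_eq0C; rewrite /= tilde_powSE.
suff h v : orth [set V x (Vn (hm (tpow T F n) H y1 (j w)))] (Vn (n := m.+1) v) by exact: h.
move: v; apply: (total_ind (ht_total_left _ (it_total _)) cQ) => -[[x' y'] h] _ ->.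
by rewrite /= tilde_powSE Vi -tilde_pow_equivariant ih.
Qed.

Local Notation FL := (htens T (fock T F) L).
Local Notation dsin n := (ds_in (dsum T (tpow T F)) (n := n)).

(** [Pi V] is this operator, up to conversion, for [VE V] and [inW V]. *)
Definition wold : H -> FL :=
  ext (fun p => Vn (hm (tpow T F (projT1 p.1)) H (projT2 p.1) (j p.2)))
      (fun p : {n & tpow T F n} * L => ht_map FL (dsin (projT1 p.1) (projT2 p.1)) p.2).

Let wold_dot (p q : {n & tpow T F n} * L) :
  dot (ht_map FL (dsin (projT1 p.1) (projT2 p.1)) p.2)
      (ht_map FL (dsin (projT1 q.1) (projT2 q.1)) q.2) =
  dot (Vn (hm (tpow T F (projT1 p.1)) H (projT2 p.1) (j p.2)))
      (Vn (hm (tpow T F (projT1 q.1)) H (projT2 q.1) (j q.2))).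
Proof.
case: p q => -[n y] w [[m y'] w'] /=; rewrite ht_dot.
case: (ltngtP n m) => nm.
- by rewrite tilde_pow_orth// ds_orth ?act0l ?dot0r//; apply/eqP; rewrite ltn_eqF.
- rewrite [RHS]dot_eq0C ?tilde_pow_orth// ds_orth ?act0l ?dot0r//.
  by apply/eqP; rewrite gtn_eqF.
- case: m / nm y' => y'.
  by rewrite ds_dot tilde_pow_isometry ht_dot -je ji.
Qed.

Lemma wold_isometry : isometry wold.
Proof. exact: (ext_isometry wold_total wold_dot). Qed.

Lemma woldE n (y : tpow T F n) w :
  wold (Vn (hm (tpow T F n) H y (j w))) = ht_map FL (dsin n y) w.
Proof. exact: (extE wold_total wold_dot (existT _ n y, w)). Qed.

Let fock_total : total (fun p : {n & tpow T F n} * L =>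
  ht_map FL (dsin (projT1 p.1) (projT2 p.1)) p.2).
Proof. exact: (ht_total_left FL (ds_total (dsum T (tpow T F)))). Qed.

Lemma wold_onto z : exists h, wold h = z.
Proof.
apply: (total_isometry_range wold_isometry fock_total) => -[[n y] w].
by eexists; exact: woldE.
Qed.

Lemma wold_equivariant : equivariant wold.
Proof.
move=> a; apply: (ext_equivariant wold_total) => -[[n y] w].
exists (existT _ n (lmod a y), w) => /=; first by rewrite -tilde_pow_equivariant ht_act.
by rewrite ht_act ds_lmod.
Qed.

(** A vector [w] orthogonal to all [act a l] satisfies [act a w = 0] for all [a], so [j w] is
    orthogonal to the total family in [H]. The definition of [vac] through [ext] relies on this
    totality. *)
Lemma wandering_nondegenerate : nondegenerate L.
Proof.
apply: total_orth => w wo.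
have actw a : act a w = 0.
  apply: eq_dotr => z; rewrite dot0r -[a]cadjK -act_adj.
  exact: (wo (cadj a, z)).
apply: dot_eq0; rewrite -ji; apply: dot_eq0C.
rewrite [j w](_ : _ = 0) ?dot0r//.
apply: (total_orth_eq0 H_nondeg) => -[a h] /=.
by rewrite act_adj -je actw (linear_fun0 (isometry_linear ji)) dot0r.
Qed.

Lemma vac_wold : @vac _ _ T F L =1 wold \o j.
Proof.
apply: ext_eq; first exact: wandering_nondegenerate.
  exact: isometry_bounded_op (isometry_comp ji wold_isometry).
by move=> [a w] /=; rewrite je -[act a (j w)]tilde_pow0E woldE.
Qed.

(** A single shift is not isometric, so the bounded operator sought by [ext] is supplied as the
    conjugate of [V x] by [wold]. *)
Lemma ind_shift_wold x h : @ind_shift _ _ T F L x (wold h) = wold (V x h).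
Proof.
have -> : @ind_shift _ _ T F L x =1 wold \o V x \o adj wold; last first.
  by rewrite /= (isometryK wold_isometry).
apply: ext_eq => //.
  apply: bounded_op_comp (adj_bounded_op wold_isometry) _.
  apply: bounded_op_comp (tensor_isometric_bounded_op x) _.
  exact: isometry_bounded_op wold_isometry.
move=> [[n y] w] /=; rewrite -woldE (isometryK wold_isometry) -tilde_powSE.
exact: woldE.
Qed.

Lemma tilde_ind_shift_wold x h :
  tilde (@ind_shift _ _ T F L) (hm F FL x (wold h)) = wold (V x h).
Proof.
rewrite tildeE ?ind_shift_wold// => y z u v.
have [h1 <-] := wold_onto u; have [h2 <-] := wold_onto v.
by rewrite !ind_shift_wold -wold_equivariant !wold_isometry Vi.
Qed.

Lemma tilde_ind_shift_isometry :
  isometry (tilde (@ind_shift _ _ T F L) : htens T F FL -> FL).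
Proof.
apply: tilde_isometry => y z u v.
have [h1 <-] := wold_onto u; have [h2 <-] := wold_onto v.
by rewrite !ind_shift_wold -wold_equivariant !wold_isometry Vi.
Qed.

End Wold.

(** * The unitaries U and U' *)

Lemma tensop_range_orth (R : realType) (A : cstarAlgType R) (T : realization A)
    (F : corrType A) (K H : repType A) (f : K -> H) (y : htens T F K) z :
  isometry f -> equivariant f -> tset T F (orth (range f)) z ->
  dot (tensop idfun f y) z = 0.
Proof.
move=> fi fe oz; apply: (tset_orth (S := range f)) oz.
- apply: (closed_invariant_orth _).2 => a _ [x _ <-].
  by exists (act a x).
- by move=> h k fh ok; exact: (ok _ fh).
- by rewrite -(tset_tensop T F setT fi fe); exists y => //; exact: tsetT.
Qed.

Section Factor.
Variables (R : realType) (A : cstarAlgType R) (T : realization A).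
Variables (F G : corrType A) (H : repType A) (VF : F -> H -> H) (VG : G -> H -> H).
Hypothesis VFi : tensor_isometric VF.
Hypothesis VGi : tensor_isometric VG.
Hypothesis VF_lmod : forall a x h, VF (lmod a x) h = act a (VF x h).
Hypothesis VG_lmod : forall a x h, VG (lmod a x) h = act a (VG x h).

Local Notation tF := (tilde VF : htens T F H -> H).
Local Notation tG := (tilde VG : htens T G H -> H).
Local Notation tFG := (tF \o (tensop idfun tG : htens T F (htens T G H) -> _)).
Local Notation tGF := (tG \o (tensop idfun tF : htens T G (htens T F H) -> _)).
Local Notation WF := (orth (range tF)).
Local Notation WG := (orth (range tG)).
Local Notation VGWF := (tG @` tset T G WF).

(** The condition is symmetric in the two orders, so exchanging [F] and [G] turns the results for
    [U'] into those for [U]. *)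
Hypothesis VFG : range tFG = range tGF.

Let tFi : isometry tF. Proof. exact: tilde_isometry. Qed.
Let tGi : isometry tG. Proof. exact: tilde_isometry. Qed.
Let tFe : equivariant tF. Proof. exact: tilde_equivariant_isometry. Qed.
Let tGe : equivariant tG. Proof. exact: tilde_equivariant_isometry. Qed.
Let ItGi : isometry (tensop idfun tG : htens T F (htens T G H) -> _).
Proof. exact: tensop_isometry. Qed.

Let W_GF : orth (range tFG) = orth (range tGF). Proof. by rewrite VFG. Qed.

Lemma range_closed_invariant : closed_invariant WF.
Proof.
apply: closed_invariant_orth => a _ [z _ <-]; exists (act a z) => //; exact: tFe.
Qed.

Lemma image_tset_subspace : closed_subspace VGWF.
Proof. exact: (isometry_image_subspace tGi (tset_subspace T G WF)). Qed.

Lemma image_tset_act a h : VGWF h -> VGWF (act a h).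
Proof.
move=> [z Wz <-]; exists (act a z); last exact: tGe.
apply: (tset_map (act_bounded a) _ Wz) => x k Wk; rewrite ht_act.
exact: tset_ht_map.
Qed.

(** For completeness of the sum: a vector orthogonal to [WG] is [tG z]. Orthogonality to the second
    summand and to the range of [tGF] makes [z] orthogonal to [G] tensored with [WF] and with the
    range of [tF], which together fill [G (x) H]. *)
Lemma wandering_decomposition : orth_dsum (orth (range tFG)) WG VGWF.
Proof.
apply: orth_dsum_intro.
- exact: orth_closed.
- exact: orth_closed.
- exact: image_tset_subspace.
- rewrite W_GF; apply: orthS => _ [z _ <-]; exact: imageT.
- rewrite W_GF => _ [z Wz <-] _ [y _ <-] /=; rewrite tGi.
  exact: tensop_range_orth.
- by move=> x y Wx [z _ <-]; apply/dot_eq0C/Wx; exists z.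
- move=> x Wx o1 o2.
  have [z _ zx] : range tG x by apply: orth_orth o1; exact: isometry_range_subspace.
  move: Wx; rewrite W_GF -zx => Wx.
  suff -> : z = 0 by exact: linear_fun0 (isometry_linear tGi).
  apply: (total_orth_eq0 (ht_total (htens T G H))) => -[y h] /=.
  have [[v _ vh] oh] := projP h (isometry_range_subspace tFi).
  rewrite -[h](subrK (tF v)) vh.
  have := ht_linearr (htens T G H) y 1 (h - proj (range tF) h) (proj (range tF) h).
  rewrite !scale1r => ->; rewrite dotDl.
  have -> : dot (ht_map (htens T G H) y (h - proj (range tF) h)) z = 0.
    rewrite -tGi zx; apply: o2; exists (ht_map (htens T G H) y (h - proj (range tF) h)) => //.
    exact: tset_ht_map.
  rewrite add0r -vh -tGi; apply: Wx.
  exists (ht_map (htens T G (htens T F H)) y v) => //=.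
  by rewrite tensopE.
Qed.

Lemma wandering_decomposition_tensor :
  orth_dsum (tset T F (orth (range tFG))) (tset T F WG) (tset T F VGWF).
Proof.
apply: tset_orth_dsum wandering_decomposition.
- exact: orth_closed.
- exact: image_tset_subspace.
- exact: image_tset_act.
Qed.

Lemma tset_image : tset T F VGWF = tensop idfun tG @` tset T F (tset T G WF).
Proof. by rewrite tset_tensop. Qed.

Lemma block_adj p :
  block VF VG p = (tF p.1, assocV (adj (tensop idfun tG) p.2) : htens T (tens T F G) H).
Proof. by rewrite /block tensop_adj. Qed.

(** The adjoint in the second entry is isometric only on the range of [tensop idfun tG]; that range
    contains the second domain, where the adjoint undoes [tensop idfun tG]. *)
Lemma block_unitary :
  unitary_on (tset T F WG `*` tset T F VGWF) (block VF VG)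
    (tF @` tset T F WG `*` tset T (tens T F G) WF).
Proof.
have bF := isometry_bounded_op tFi.
have bA := bounded_op_comp (adj_bounded_op ItGi)
  (isometry_bounded_op (@assocV_isometry _ _ T F G H)).
split.
- by move=> k p q _ _; rewrite !block_adj /=; congr pair; [exact: bF.1|exact: bA.1].
- move=> p q [_ Dp] [_ Dq]; rewrite !block_adj /= tFi; congr (_ + _).
  move: Dp Dq; rewrite tset_image => -[u _ <-] [v _ <-].
  by rewrite assocV_isometry !isometryK// ItGi.
- apply/seteqP; split=> [_ [p [Dp1 Dp2] <-]|[y1 y2] [/= [x1 Dx1 <-] Wy2]].
    rewrite block_adj; split=> /=; first by exists p.1.
    move: Dp2; rewrite tset_image => -[u Wu <-]; rewrite isometryK//.
    by rewrite -tset_assocV; exists u.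
  move: Wy2; rewrite -tset_assocV => -[u Wu <-].
  exists (x1, tensop idfun tG u); last by rewrite block_adj/= isometryK.
  by split=> //=; rewrite tset_image; exists u.
Qed.

(** The first two clauses make the complementary projection act as the identity on [u.1], the third
    does the same for the projection inside the second term, and the last splits [tF z]
    accordingly. *)
Lemma block_components z : tset T F (orth (range tFG)) z ->
  let u := block VF VG (components (tset T F WG) (tset T F VGWF) z) in
  [/\ orth (range tFG) u.1, orth WF u.1, tset T (tens T F G) WF u.2 &
      tF z = u.1 + tFG (assoc u.2)].
Proof.
have [d12 dE] := wandering_decomposition_tensor.
rewrite dE => -[z1 z1G [z2 z2F <-]] u.
rewrite {}/u (components_add _ _ d12)//; try exact: tset_subspace.
move: (z2F); rewrite tset_image => -[q qW qE].
rewrite block_adj /= -qE isometryK// assocVK; split.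
- move=> _ [y _ <-] /=; rewrite tFi.
  exact: tensop_range_orth.
- by move=> h oh; apply/dot_eq0C/oh; exists z1.
- by rewrite -tset_assocV; exists q.
- have := isometry_linear tFi 1 z1 (tensop idfun tG q).
  by rewrite !scale1r.
Qed.

End Factor.

(** * The BCL-representation *)

Section Subrepresentation.
Variables (R : realType) (A : cstarAlgType R) (H : repType A) (K : set H).
Hypothesis hK : closed_invariant K.
Local Notation incl := (@subrep_val _ _ _ _ hK).

Lemma subrep_val_isometry : isometry incl.
Proof. by []. Qed.

Lemma subrep_val_equivariant : equivariant incl.
Proof. by []. Qed.

Lemma range_subrep_val : range incl = K.
Proof.
apply/seteqP; split=> [_ [x _ <-]|x Kx]; first by have := valP x; rewrite inE.
by exists (exist _ x (mem_set Kx)).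
Qed.

End Subrepresentation.

Section BCL.
Variables (R : realType) (A : cstarAlgType R) (T : realization A).
Variables (E : product_system T) (H : repType A) (V : isometric_rep E H).
Local Notation E1 := (ps1 E).
Local Notation E2 := (ps2 E).
Local Notation V1 := (Defs.V1 V).
Local Notation V2 := (Defs.V2 V).
Local Notation hm G K := (ht_map (htens T G K)).
Local Notation FW := (htens T (fock T (ps E)) (W V)).

Lemma V1_tensor_isometric : tensor_isometric V1.
Proof. by move=> x y h k; exact: V1_isom. Qed.

Lemma V2_tensor_isometric : tensor_isometric V2.
Proof. by move=> x y h k; exact: V2_isom. Qed.

Lemma V1_lmod a x h : V1 (lmod a x) h = act a (V1 x h).
Proof. exact: cov_lmod (rep_nondeg V) (V1_cov V) (@V1_isom _ _ _ _ _ V) a x h. Qed.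

Lemma V2_lmod a x h : V2 (lmod a x) h = act a (V2 x h).
Proof. exact: cov_lmod (rep_nondeg V) (V2_cov V) (@V2_isom _ _ _ _ _ V) a x h. Qed.

Let t1i := @tilde_isometry _ _ T _ _ _ _ V1_tensor_isometric.
Let t2i := @tilde_isometry _ _ T _ _ _ _ V2_tensor_isometric.
Let t1e := @tilde_equivariant_isometry _ _ T _ _ _ _ V1_lmod.
Let t2e := @tilde_equivariant_isometry _ _ T _ _ _ _ V2_lmod.

Lemma tildeV_isometry : isometry (tildeV V).
Proof. by apply: isometry_comp t1i; exact: tensop_isometry. Qed.

Lemma tildeV_equivariant : equivariant (tildeV V).
Proof.
apply: equivariant_comp t1e => a; exact: tensop_equivariant.
Qed.

Lemma VE_tensor_isometric : tensor_isometric (VE V).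
Proof. by move=> x y h k; rewrite /VE tildeV_isometry assoc_isometry ht_dot. Qed.

Lemma VE_lmod a x h : VE V (lmod a x) h = act a (VE V x h).
Proof. by rewrite /VE -tildeV_equivariant -assoc_equivariant ht_act. Qed.

Lemma tilde_VE : tilde (VE V) =1 tildeV V \o assoc (H := H).
Proof.
apply: ext_eq; [exact: ht_total| |by []].
exact/isometry_bounded_op/(isometry_comp _ tildeV_isometry)/assoc_isometry.
Qed.

Lemma range_tilde_VE : range (tilde (VE V) : htens T (ps E) H -> H) = range (tildeV V).
Proof.
apply/seteqP; split=> [_ [z _ <-]|_ [z _ <-]].
  by rewrite tilde_VE; exists (assoc z).
by exists (assocV z) => //; rewrite tilde_VE /= assocVK.
Qed.

Lemma inW_isometry : isometry (inW V).
Proof. exact: subrep_val_isometry. Qed.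

Lemma inW_equivariant : equivariant (inW V).
Proof. exact: subrep_val_equivariant. Qed.

Lemma range_inW : range (inW V) = Wset V.
Proof. exact: range_subrep_val. Qed.

Lemma range_inW_tilde : range (inW V) = orth (range (tilde (VE V) : htens T (ps E) H -> H)).
Proof. by rewrite range_inW range_tilde_VE. Qed.

Lemma t12_hdot x y : hdot (t12 E x) (t12 E y) = hdot x y.
Proof. by rewrite -t21_hdot !t12K. Qed.

Lemma tensop_t21K : cancel
  (tensop (t21 E) idfun : htens T (tens T E2 E1) H -> htens T (tens T E1 E2) H)
  (tensop (t12 E) idfun).
Proof.
apply: (total_bounded_op_eq (ht_total _)) => [||[x h]].
- apply: isometry_bounded_op; apply: isometry_comp.
    by apply: tensop_isometry => //; exact: t21_hdot.
  by apply: tensop_isometry => //; exact: t12_hdot.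
- exact: (@isometry_bounded_op _ _ _ id).
- rewrite /= tensopE //; last exact: t21_hdot.
  by rewrite tensopE ?t21K//; exact: t12_hdot.
Qed.

(** The commutation relation is given through [t12]; evaluating it at a vector flipped by [t21]
    cancels the flip. *)
Lemma tildeV_t21 u :
  tildeV V (assoc (tensop (t21 E) idfun u)) =
  tilde V2 (tensop idfun (tilde V1) (assoc u)).
Proof. by rewrite /tildeV /= V12 tensop_t21K. Qed.

(** The flip and [assoc] are bijective, so the commutation relation equates the ranges of the two
    composites; this is the hypothesis [VFG]. *)
Lemma range_tildeV : range (tildeV V) =
  range (tilde V2 \o (tensop idfun (tilde V1) : htens T E2 (htens T E1 H) -> _)).
Proof.
apply/seteqP; split=> [_ [z _ <-]|_ [z _ <-]].
  by rewrite -[z]assocVK /tildeV /= V12; eexists.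
by rewrite -[z]assocVK /= -tildeV_t21; eexists.
Qed.

Hypothesis V_pure : pure_rep V.

Lemma Pi_isometry : isometry (Pi V).
Proof.
exact: (wold_isometry (rep_nondeg V) VE_tensor_isometric VE_lmod
  inW_isometry inW_equivariant range_inW_tilde V_pure).
Qed.

Lemma Pi_equivariant : equivariant (Pi V).
Proof.
exact: (wold_equivariant (rep_nondeg V) VE_tensor_isometric VE_lmod
  inW_isometry range_inW_tilde V_pure).
Qed.

Lemma vacW_Pi w : vacW w = Pi V (inW V w).
Proof.
exact: (vac_wold (rep_nondeg V) VE_tensor_isometric VE_lmod
  inW_isometry inW_equivariant range_inW_tilde V_pure).
Qed.

Lemma tildeS_isometry : isometry (@tildeS _ _ _ _ _ V).
Proof.
exact: (tilde_ind_shift_isometry (rep_nondeg V) VE_tensor_isometric VE_lmod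
  inW_isometry inW_equivariant range_inW_tilde V_pure).
Qed.

Lemma tildeS_Pi x h : tildeS (hm (ps E) FW x (Pi V h)) = Pi V (VE V x h).
Proof.
exact: (tilde_ind_shift_wold (rep_nondeg V) VE_tensor_isometric VE_lmod
  inW_isometry inW_equivariant range_inW_tilde V_pure).
Qed.

(** * Projections onto an invariant subspace of [W], later [W1] or [W2] *)

Section WanderingSubspace.
Variable M : set H.
Hypothesis hM : closed_invariant M.
Hypothesis MW : M `<=` Wset V.
Local Notation k := (@subrep_val _ _ _ _ hM).

Let cs_preim : closed_subspace [set w | M (inW V w)].
Proof. exact: closed_subspace_preimage (isometry_bounded_op inW_isometry) hM.1. Qed.

(** Because [M] lies in [W], projecting first onto [W] and then onto [M] is the projection of [H]
    onto [M]. *)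
Lemma vacW_PW_toW h : vacW (PW M (toW V h)) = Pi V (proj M h).
Proof.
have [Mp op] := projP h hM.1.
have [w _ wp] : range (inW V) (proj M h) by rewrite range_inW; exact: MW.
rewrite vacW_Pi -wp; congr (Pi V (inW V _)).
apply: proj_eq => //=; first by rewrite wp.
move=> y My; rewrite dotBr -(adjP inW_isometry) -(inW_isometry y w) wp -dotBr.
exact: op.
Qed.

Lemma vacW_PWperp_toW h : Wset V h -> orth M h -> vacW (PWperp M (toW V h)) = Pi V h.
Proof.
rewrite -range_inW => -[w _ <-] ow.
rewrite /toW (isometryK inW_isometry) vacW_Pi; congr (Pi V (inW V _)).
rewrite /PWperp /PW (proj_eq (y := 0)) ?subr0//; first by case: cs_preim.
by move=> y My; rewrite -(inW_isometry y w); exact: ow.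
Qed.

(* P_M is k k^* for the inclusion k of M, so t (x) vac P_M extends to the
   bounded operator (t (x) Pi k) (I (x) k)^*. *)
Lemma tildeS_tensop_PW (F : corrType A) (t : F -> ps E) :
  (forall x y, hdot (t x) (t y) = hdot x y) ->
  forall u : htens T F H, tset T F M u ->
  tildeS (tensop t (fun h => vacW (PW M (toW V h))) u) =
  Pi V (tilde (VE V) (tensop t idfun u)).
Proof.
move=> ti u Mu.
have ki := @subrep_val_isometry _ _ _ _ hM.
have ke := @subrep_val_equivariant _ _ _ _ hM.
have kM : range k = M by exact: range_subrep_val.
have Pki : isometry (Pi V \o k) by exact: isometry_comp ki Pi_isometry.
have Pke : equivariant (Pi V \o k) by exact: equivariant_comp ke Pi_equivariant.
have Iki : isometry (tensop idfun k : htens T F _ -> htens T F H) by exact: tensop_isometry.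
have projE h : proj M h = k (adj k h).
  apply: proj_eq; first exact: hM.1.
    by rewrite -[in X in X _]kM; exists (adj k h).
  rewrite -[in orth _]kM => _ [x _ <-].
  by rewrite dotBr (adjP ki) ki subrr.
have -> : tensop t (fun h => vacW (PW M (toW V h))) u =
    tensop t (Pi V \o k) (adj (tensop idfun k) u).
  move: u {Mu}; apply: ext_eq; first exact: ht_total.
    apply: bounded_op_comp (adj_bounded_op Iki) _.
    exact/isometry_bounded_op/tensop_isometry.
  move=> [x h] /=; rewrite adj_tensopE// tensopE//=.
  by rewrite vacW_PW_toW projE.
(* Writing [u] as [tensop idfun k q] cancels the adjoint; both sides are then isometric in [q] and
   may be compared on elementary tensors. *)
have : tset T F (range k) u by rewrite kM.
rewrite -(tset_tensop T F setT ki ke) => -[q _ <-].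
rewrite isometryK//; move: q.
have VEi := tilde_isometry (T := T) VE_tensor_isometric.
have tii : isometry (tensop t idfun : htens T F H -> htens T (ps E) H).
  exact: tensop_isometry.
have tPi : isometry (tensop t (Pi V \o k) : htens T F _ -> htens T (ps E) FW).
  exact: tensop_isometry.
apply: (total_bounded_op_eq (ht_total _)) => [||[x w]].
- exact/isometry_bounded_op/(isometry_comp tPi)/tildeS_isometry.
- exact: (isometry_bounded_op (isometry_comp Iki (isometry_comp tii
    (isometry_comp VEi Pi_isometry)))).
- by rewrite /= !tensopE//= tildeS_Pi tildeE//; exact: VE_tensor_isometric.
Qed.

End WanderingSubspace.

(** [vacW w] is [Pi V (inW V w)], so the adjoint of [Pi V] returns [w], and the symbol at [w] is
    [Pi V] applied to [VF x w]. *)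
Lemma tilde_Theta (F : corrType A) (VF : F -> H -> H) :
  tensor_isometric VF ->
  forall z : htens T F (W V),
  tilde (fun x w => Pi V (VF x (adj (Pi V) (vacW w)))) z =
  Pi V (tilde VF (tensop idfun (inW V) z)).
Proof.
move=> VFi; have Iji : isometry (tensop idfun (inW V) : htens T F _ -> htens T F H).
  exact: tensop_isometry.
apply: ext_eq; first exact: ht_total.
  exact: (isometry_bounded_op (isometry_comp Iji
    (isometry_comp (tilde_isometry VFi) Pi_isometry))).
move=> [x w] /=; rewrite tensopE//.
by rewrite tildeE// vacW_Pi (isometryK Pi_isometry).
Qed.

End BCL.

Theorem theorem2p5 (R : realType) (A : cstarAlgType R) (T : realization A)
    (E : product_system T) (H : repType A) (V : isometric_rep E H)
    (V_pure : pure_rep V) :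
  let E1 := ps1 E in let E2 := ps2 E in
  let E1W2 := tset T E1 (W2 V) in
  let E2W1 := tset T E2 (W1 V) in
  let V1E1W2 := tilde (V1 V) @` E1W2 in
  let V2E2W1 := tilde (V2 V) @` E2W1 in
  [/\ orth_dsum (tset T E1 (Wset V)) E1W2 (tset T E1 V2E2W1) /\
      orth_dsum (tset T E2 (Wset V)) E2W1 (tset T E2 V1E1W2),
      unitary_on (E1W2 `*` tset T E1 V2E2W1) (U' V)
                 (V1E1W2 `*` tset T (tens T E1 E2) (W1 V)),
      unitary_on (E2W1 `*` tset T E2 V1E1W2) (U V)
                 (V2E2W1 `*` tset T (tens T E2 E1) (W2 V)),
      forall z : htens T E1 (W V),
        let u := U' V (components E1W2 (tset T E1 V2E2W1)
                         (tensop idfun (inW V) z)) in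
        tilde (Theta1 V) z =
          vacW (PWperp (W1 V) (toW V u.1)) +
          tildeS (tensop idfun (fun h => vacW (PW (W1 V) (toW V h))) u.2) &
      forall z : htens T E2 (W V),
        let u := U V (components E2W1 (tset T E2 V1E1W2)
                        (tensop idfun (inW V) z)) in
        tilde (Theta2 V) z =
          vacW (PWperp (W2 V) (toW V u.1)) +
          tildeS (tensop (t21 E)
                    (fun h => vacW (PW (W2 V) (toW V h))) u.2)].

Proof.
move=> E1 E2 E1W2 E2W1 V1E1W2 V2E2W1.
have V1i := V1_tensor_isometric V; have V2i := V2_tensor_isometric V.
have V1l := @V1_lmod _ _ _ _ _ V; have V2l := @V2_lmod _ _ _ _ _ V.
have rV := range_tildeV V.
(* [Wset] is defined with [V1] outermost; this form, with [V2] outermost, is the one met after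
   exchanging the roles, and it shows that [W2] lies in [W]. *)
have WV : Wset V = orth (range (tilde (V2 V) \o
    (tensop idfun (tilde (V1 V)) : htens T E2 (htens T E1 H) -> _))).
  by rewrite /Wset rV.
have hW1 := range_closed_invariant T V1l.
have hW2 := range_closed_invariant T V2l.
have W1W : W1 V `<=` Wset V.
  by apply: orthS => _ [z _ <-]; exact: imageT.
have W2W : W2 V `<=` Wset V.
  by rewrite WV; apply: orthS => _ [z _ <-]; exact: imageT.
have inW_tset (F : corrType A) (z : htens T F (W V)) :
    tset T F (Wset V) (tensop idfun (inW V) z).
  rewrite -range_inW -tset_tensop//; exists z => //; exact: tsetT.
split; [split| | | |].
- exact: wandering_decomposition_tensor V1i V2i V1l V2l rV.
- rewrite WV; exact: wandering_decomposition_tensor V2i V1i V2l V1l (esym rV).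
- exact: block_unitary.
- exact: block_unitary.
- move=> z u.
  have [uW uo uT uE] := block_components V1i V2i V1l V2l rV (inW_tset _ z).
  rewrite [LHS](tilde_Theta V_pure V1i z) uE -/u.
  rewrite (isometryD (Pi_isometry V_pure)).
  congr (_ + _); first by rewrite vacW_PWperp_toW.
  by rewrite (tildeS_tensop_PW V_pure hW1)// tensop_id tilde_VE.
- move=> z u.
  have zW : tset T E2 (orth (range (tilde (V2 V) \o
      (tensop idfun (tilde (V1 V)) : htens T E2 (htens T E1 H) -> _))))
      (tensop idfun (inW V) z).
    by rewrite -WV; exact: inW_tset.
  have [uW uo uT uE] := block_components V2i V1i V2l V1l (esym rV) zW.
  rewrite -WV in uW.
  rewrite [LHS](tilde_Theta V_pure V2i z) uE -/u.
  rewrite (isometryD (Pi_isometry V_pure)).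
  congr (_ + _); first by rewrite vacW_PWperp_toW.
  (* The second entry of [U] lives over [E2 (x) E1], so the module map is [t21], and its
     preservation of inner products is the remaining condition. *)
  rewrite (tildeS_tensop_PW V_pure hW2)//; last exact: t21_hdot.
  by rewrite tilde_VE /= tildeV_t21.
Qed.
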